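(* The online exploration algorithm $\textsc{Blocking}_{\log(n)}$ (i.e. $\textsc{Blocking}_\delta$ with $\delta=\log(n)$, where $n$ is the number of vertices of the input graph) is $O(\log(n))$-competitive on all graphs: there is a constant $C$ such that $\textsc{Blocking}_{\log(n)}(G,v)\le C\log(n)\cdot\textsc{Opt}(G)$ for every connected undirected graph $G$ with $n$ vertices and non-negative edge weights and every start vertex $v$.
   Context: Online graph exploration: an agent starts at a vertex $v$ of an initially unknown connected undirected graph $G=(V,E)$ with edge weights $w\colon E\to\mathbb{R}_{\ge 0}$. When the agent visits a vertex it learns the identifiers of all adjacent vertices and the weights of the incident edges. Traversing an edge costs its weight. The agent must visit all vertices and return to $v$. $\textsc{Alg}(G,v)$ denotes the total cost of algorithm $\textsc{Alg}$, and $\textsc{Opt}(G)$ the length of a shortest closed walk visiting all vertices. Competitiveness must hold for every way the algorithm makes its free choices. Algorithm $\textsc{Blocking}_\delta$ ($\delta>0$, possibly depending on $n$). A vertex is explored once visited. A boundary edge $e=(u,x)$ is an edge with $u$ explored and $x$ unexplored. For vertices $x,y$, $d(x,y)$ is the current length of a shortest path from $x$ to $y$ all of whose internal vertices are explored. A boundary edge $e=(u,x)$ is $\delta$-blocked if there is another boundary edge $e'=(u',x')$ with $w(e')<w(e)$ and $d(u,x')\le(1+\delta)w(e)$. The recursive procedure $\textsc{Blocking}_\delta(v)$ ($v$ the current position) is: while there is a boundary edge $e=(y,x)$ that is not $\delta$-blocked and such that either $y=v$ or $e$ was at some earlier time $\delta$-blocked by a boundary edge whose unexplored endpoint was $v$,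 do: traverse a shortest internally explored path from $v$ to $y$; traverse $e$; call $\textsc{Blocking}_\delta(x)$; traverse a shortest internally explored path from $x$ back to $v$. The algorithm is the call at the start vertex; ties among qualifying edges are broken arbitrarily. *)

(* Defs.v *)
From HB Require Import structures.
From mathcomp Require Import all_boot all_order all_algebra.
From mathcomp Require Import all_classical all_reals all_analysis.

Set Implicit Arguments.
Unset Strict Implicit.
Unset Printing Implicit Defensive.

Import Order.TTheory GRing.Theory Num.Theory.

Local Open Scope classical_set_scope.
Local Open Scope ring_scope.

(* Finite simple graphs with non-negative edge weights; the value of [weight]
   on non-adjacent pairs is irrelevant and left unconstrained. *)
Record wgraph (R : realType) := WGraph {
  vertex :> finType;
  edge : rel vertex;
  weight : vertex -> vertex -> R;
  edge_sym : symmetric edge;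
  edge_irrefl : irreflexive edge;
  weight_sym : forall x y, edge x y -> weight x y = weight y x;
  weight_ge0 : forall x y, edge x y -> 0 <= weight x y
}.

Definition connected_graph (R : realType) (G : wgraph R) : Prop :=
  forall x y : G, connect (@edge R G) x y.

(* A walk is given by its start vertex [x] and the sequence [p] of the
   vertices that follow. *)
Fixpoint walk_length (R : realType) (G : wgraph R) (x : G) (p : seq G) : R :=
  if p is y :: q then weight x y + walk_length y q else 0.

Definition closed_tour (R : realType) (G : wgraph R) (x : G) (p : seq G) : Prop :=
  [/\ path (@edge R G) x p, last x p = x & forall z : G, z \in x :: p].

Definition opt (R : realType) (G : wgraph R) : \bar R :=
  ereal_inf [set l | exists (x : G) (p : seq G),
                       closed_tour x p /\ l = (walk_length x p)%:E].

Section Blocking.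
Variables (R : realType) (G : wgraph R).
Implicit Types (S : {set G}) (h p : seq G) (u v x y : G).

(* Paths (without repeated vertex) from [x] to [y] whose internal vertices all
   belong to [S]; the end points need not be in [S]. *)
Definition internal_path S x y p : Prop :=
  [/\ path (@edge R G) x p, last x p = y, uniq (x :: p)
    & all (fun z => z \in S) (behead (belast x p))].

(* +oo if there is no such path. *)
Definition dist S x y : \bar R :=
  ereal_inf [set l | exists p, internal_path S x y p /\
                               l = (walk_length x p)%:E].

Definition shortest_path S x y p : Prop :=
  internal_path S x y p /\ (walk_length x p)%:E = dist S x y.

(* In the following, [S] is the set of explored vertices. *)
Definition boundary S u x : Prop := [/\ edge u x, u \in S & x \notin S].

Definition blocked_by (delta : R) S u x u' x' : Prop :=
  [/\ boundary S u x, boundary S u' x', weight u' x' < weight u x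
    & (dist S u x' <= ((1 + delta) * weight u x)%:E)%E].

Definition blocked (delta : R) S u x : Prop :=
  exists u' x', blocked_by delta S u x u' x'.

(* A history [h] lists the explored vertices, the most recently explored one
   first. The explored set changes only when a new vertex is visited, so the
   explored sets of the past are those of the suffixes [drop k h]. *)
Definition explored h : {set G} := [set:: h]%SET.

Definition eligible (delta : R) h v y x : Prop :=
  [/\ boundary (explored h) y x, ~ blocked delta (explored h) y x
    & y = v \/ exists k u', blocked_by delta (explored (drop k h)) y x u' v].

(* [blocking delta v h p h']: the while loop of the call at [v], entered with
   history [h], can follow the walk [v :: p] and terminate with history [h'].
   The relation ranges over all choices of eligible edges and of shortest
   paths. Every iteration explores a new vertex, so no execution is infinite. *)
Inductive blocking (delta : R) : G -> seq G -> seq G -> seq G -> Prop :=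
| Blocking_stop v h :
    (forall y x, ~ eligible delta h v y x) ->
    blocking delta v h [::] h
| Blocking_step v h y x p q h1 r s h2 :
    eligible delta h v y x ->
    shortest_path (explored h) v y p ->
    blocking delta x (x :: h) q h1 ->
    shortest_path (explored h1) x v r ->
    blocking delta v h1 s h2 ->
    blocking delta v h (p ++ x :: q ++ r ++ s) h2.

Definition blocking_run (delta : R) v p : Prop :=
  exists h, blocking delta v [:: v] p h.

End Blocking.

(* Main.v *)
Require Import Defs.
From HB Require Import structures.
From mathcomp Require Import all_boot all_order all_fingroup all_algebra.
From mathcomp Require Import all_classical all_reals all_analysis.
From mathcomp Require Import ring lra zify.

(** Every vertex [x] but the start is entered through one charged edge [(y, x)],
    and the detour made for it costs at most [2 * (2 + delta)] times its weight,
    because [(y, x)] was once blocked by an edge ending at the current position.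
    So it suffices to bound the weight of the set [D] of charged edges by a
    constant times the weight of a minimum spanning tree [T].

    Choose [T] with as many edges in [D] as possible. Then every cycle of
    [H = T :|: D] weighs more than [2 + delta] times each of its edges: otherwise
    the heaviest edge of the cycle that is charged last would be blocked when it
    is charged.

    That such an [H] has weight [O(weight of T)] for [delta = ln n] is shown by a
    random clustering at every scale [W]: with a random order of the vertices and
    a random radius [r] in [[delta W / 6, delta W / 3]], every vertex joins the
    first center within distance [r]. Inside a cluster, the edges of weight at
    least [W] lie on no cycle, so at most as many edges of [D :\: T] of weight
    about [W] are kept as edges of [T] are cut. An edge of [D] of this weight is
    kept with probability at least [exp (- 24)], while an edge [f] of [T] is cut
    with probability [O(weight f / (delta W) * ln (N_f(delta W / 3) / N_f(delta W / 12)))],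
    where [N_f(r)] is the number of vertices within distance [r] of [f]. Summed
    over the dyadic scales the logarithms telescope to [O(ln n)]. *)

Set Implicit Arguments.
Unset Strict Implicit.
Unset Printing Implicit Defensive.

Import Order.TTheory GRing.Theory Num.Theory.

Local Open Scope ring_scope.

(** * Walks and edge sets *)

Section Walks.
Variables (R : realType) (G : wgraph R).
Implicit Types (x y z : G) (p q : seq G) (A D T : {set {set G}}).

Lemma walk_length_cat x p q :
  walk_length x (p ++ q) = walk_length x p + walk_length (last x p) q.
Proof. by elim: p x => [|y p IH] x /=; rewrite ?add0r // IH addrA. Qed.

Lemma walk_length_ge0 x p : path (@edge R G) x p -> 0 <= walk_length x p.
Proof.
elim: p x => [|y p IH] x //= /andP[exy pp].
by rewrite addr_ge0 ?IH // weight_ge0.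
Qed.

Lemma path_edge_rev x p :
  path (@edge R G) x p -> path (@edge R G) (last x p) (rev (belast x p)).
Proof. by rewrite rev_path; apply: sub_path => a b; rewrite edge_sym. Qed.

Lemma last_rev_belast x y p : last y (rev (belast x p)) = if p is [::] then y else x.
Proof. by case: p => [|z p] //=; rewrite rev_cons last_rcons. Qed.

Lemma last_rev_last x p : last (last x p) (rev (belast x p)) = x.
Proof. by rewrite last_rev_belast; case: p. Qed.

Lemma walk_length_rev x p :
  path (@edge R G) x p ->
  walk_length (last x p) (rev (belast x p)) = walk_length x p.
Proof.
elim: p x => [|y p IH] x //= /andP[exy pp].
rewrite rev_cons -cats1 walk_length_cat IH //= last_rev_last addr0 addrC.
by rewrite -weight_sym.
Qed.

(** Every cut argument below rests on this: it isolates the first step of a walk that leaves [P],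
    and records that the whole prefix satisfies [P]. *)
Lemma first_exit (e : rel G) (P : G -> Prop) x p :
  path e x p -> P x -> ~ P (last x p) ->
  exists p1 d p2, [/\ p = p1 ++ d :: p2, (forall z, z \in x :: p1 -> P z),
    ~ P d & e (last x p1) d].
Proof.
elim: p x => [|y p IH] x //= /andP[exy pp] Px nPl.
case: (pselect (P y)) => Py; last first.
  by exists [::], y, p; split => // z; rewrite inE => /eqP ->.
have [p1 [d [p2 [-> Pp1 nPd ed]]]] := IH y pp Py nPl.
exists (y :: p1), d, p2; split => // z.
by rewrite inE => /orP[/eqP -> //|]; exact: Pp1.
Qed.

(** Loops are cut out; since weights are non-negative this never lengthens the walk. *)
Lemma walk_shorten (e : rel G) x p :
  subrel e (@edge R G) -> path e x p ->
  exists q, [/\ path e x q, last x q = last x p, uniq (x :: q) &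
    walk_length x q <= walk_length x p].
Proof.
move=> se; elim: p x => [|y p IH] x /=; first by exists [::].
move=> /andP[exy pp]; have [q [pq lq uq wq]] := IH y pp.
have w0 : 0 <= weight x y by rewrite weight_ge0 // se.
case: (boolP (x \in y :: q)) => xq; last first.
  exists (y :: q); split => //=; first by rewrite exy.
    by rewrite xq.
  by rewrite lerD2l.
move: xq; rewrite inE => /orP[/eqP xy|xq].
  by exists q; rewrite xy; split => //; apply: le_trans wq _; rewrite lerDr -{1}xy.
case/splitPr: xq pq lq uq wq => q1 q2.
rewrite cat_path last_cat /= => /and3P[pq1 eq1 pq2] lq uq wq.
exists q2; split => //.
  by case/andP: uq => _; rewrite cat_uniq => /and3P[].
apply: le_trans (_ : walk_length y p <= _); last by rewrite lerDr.
apply: le_trans wq; rewrite walk_length_cat /=.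
have := walk_length_ge0 (sub_path se pq1).
have := weight_ge0 (se _ _ eq1); lra.
Qed.

(** Undirected edges are encoded as two-element vertex sets, so that edge sets can be counted and
    summed without orientation. *)
Definition adj A : rel G := fun x y => [set x; y]%SET \in A.

Lemma adj_sym A : symmetric (adj A).
Proof. by move=> x y; rewrite /adj finset.setUC. Qed.

Lemma connect_adj_sym A : connect_sym (adj A).
Proof. exact/sym_connect_sym/adj_sym. Qed.

Lemma sub_adj A A' : A \subset A' -> subrel (adj A) (adj A').
Proof. by move=> /fintype.subsetP sA x y; apply: sA. Qed.

Lemma set2_eq x y x' y' :
  [set x; y]%SET = [set x'; y']%SET -> (x = x' /\ y = y') \/ (x = y' /\ y = x').
Proof.
move=> E.
have : x \in [set x'; y']%SET by rewrite -E !inE eqxx.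
have : y \in [set x'; y']%SET by rewrite -E !inE eqxx orbT.
have : x' \in [set x; y]%SET by rewrite E !inE eqxx.
have : y' \in [set x; y]%SET by rewrite E !inE eqxx orbT.
rewrite !inE => /orP[]/eqP h1 /orP[]/eqP h2 /orP[]/eqP h3 /orP[]/eqP h4; subst; tauto.
Qed.

Definition graph_edges : {set {set G}} :=
  [set [set p.1; p.2]%SET | p in [pred p : G * G | edge p.1 p.2]]%SET.

Lemma adj_graph_edges : adj graph_edges =2 @edge R G.
Proof.
move=> x y; apply/imsetP/idP => [[[a b]] /= eab /set2_eq[] [-> ->] //|exy].
  by rewrite edge_sym.
by exists (x, y).
Qed.

Lemma sub_adj_edge A : A \subset graph_edges -> subrel (adj A) (@edge R G).
Proof. by move=> sA x y /(sub_adj sA); rewrite adj_graph_edges. Qed.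

(** Either orientation may be picked, as weights are symmetric on edges. Sets that are no edge get
    the default 0. *)
Definition edge_weight (e : {set G}) : R :=
  if [pick p : G * G | (e == [set p.1; p.2]%SET) && edge p.1 p.2] is Some p
  then weight p.1 p.2 else 0.

Lemma edge_weightE x y : edge x y -> edge_weight [set x; y]%SET = weight x y.
Proof.
move=> exy; rewrite /edge_weight; case: pickP => [[a b]|/(_ (x, y))] /=; last first.
  by rewrite eqxx exy.
by case/andP => /eqP/set2_eq[] [-> ->] // eab; rewrite weight_sym.
Qed.

Lemma edge_weight_ge0 (e : {set G}) : 0 <= edge_weight e.
Proof.
rewrite /edge_weight; case: pickP => [[a b] /= /andP[_]|//].
exact: weight_ge0.
Qed.

Lemma path_adj_avoid A x p z z' :
  path (adj A) x p -> z \notin x :: p -> path (adj (A :\ [set z; z']%SET)) x p.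
Proof.
elim: p x => [|y p IH] x //= /andP[exy pp].
rewrite !inE !negb_or => /and3P[zx zy zp]; rewrite IH ?inE ?negb_or ?zy ?zp //.
rewrite andbT /adj in_setD1; apply/andP; split=> //.
by apply/eqP => /set2_eq[] [? ?]; subst; rewrite ?eqxx in zx zy.
Qed.

Lemma path_adj_rev A x p :
  path (adj A) x p -> path (adj A) (last x p) (rev (belast x p)).
Proof. by rewrite rev_path; apply: sub_path => a b; rewrite adj_sym. Qed.

Definition connected_by A : bool := [forall x, forall y, connect (adj A) x y].

Definition total_weight A : R := \sum_(e in A) edge_weight e.

Lemma connect_adj_setD1 A a b x :
  connect (adj A) a x ->
  connect (adj (A :\ [set a; b]%SET)) a x || connect (adj (A :\ [set a; b]%SET)) b x.
Proof.
case/connectP => p; elim/last_ind: p x => [|p y IH] x.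
  by move=> _ ->; rewrite connect0.
rewrite rcons_path last_rcons => /andP[pp exy] ->.
have := IH _ pp erefl.
case: (eqVneq [set last a p; y]%SET [set a; b]%SET) => [/set2_eq[][_ ->]|nE].
- by rewrite connect0 orbT.
- by rewrite connect0.
have c1 : connect (adj (A :\ [set a; b]%SET)) (last a p) y.
  by apply: connect1; rewrite /adj in_setD1 nE.
by case/orP => c; rewrite (connect_trans c c1) ?orbT.
Qed.

Lemma connect_adj_setU1 A a b x y :
  connect (adj ([set a; b]%SET |: A)) x y =
  [|| connect (adj A) x y, connect (adj A) x a && connect (adj A) b y |
      connect (adj A) x b && connect (adj A) a y].
Proof.
have sub : subrel (connect (adj A)) (connect (adj ([set a; b]%SET |: A))).
  by apply: connect_sub => u v uv; apply/connect1/(sub_adj _ uv)/finset.subsetUr.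
have ab : connect (adj ([set a; b]%SET |: A)) a b.
  by apply: connect1; rewrite /adj finset.setU11.
apply/idP/idP; last first.
  case/or3P => [/sub //|/andP[/sub xa /sub yb]|/andP[/sub xb /sub ya]].
    exact: connect_trans xa (connect_trans ab yb).
  rewrite connect_adj_sym in ab; exact: connect_trans xb (connect_trans ab ya).
case/connectP => p; elim/last_ind: p y => [|p z IH] y.
  by move=> _ ->; rewrite connect0.
rewrite rcons_path last_rcons => /andP[pp exy] ->.
have := IH _ pp erefl; move: exy; rewrite {1}/adj in_setU1.
set u := last x p => /orP[/eqP/set2_eq[][-> ->]|uz].
- by case/or3P => [->|/andP[-> _]|/andP[-> _]]; rewrite ?connect0 ?orbT.
- by case/or3P => [->|/andP[-> _]|/andP[-> _]]; rewrite ?connect0 ?orbT.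
have tr w : connect (adj A) w u -> connect (adj A) w z.
  by move=> h; apply: connect_trans h (connect1 uz).
by case/or3P => [/tr ->|/andP[-> /tr ->]|/andP[-> /tr ->]]; rewrite ?orbT.
Qed.

(** * Counting connected components by canonical representatives *)

Definition component_roots A : {set G} := [set fingraph.root (adj A) x | x in G]%SET.

Lemma component_roots_setU1 A a b :
  component_roots ([set a; b]%SET |: A) =
  [set fingraph.root (adj ([set a; b]%SET |: A)) x | x in component_roots A]%SET.
Proof.
set A' := _ |: A.
have rr x : fingraph.root (adj A') (fingraph.root (adj A) x) = fingraph.root (adj A') x.
  apply/esym/(fingraph.rootP (connect_adj_sym A')); rewrite connect_adj_setU1.
  by rewrite connect_root.
apply/setP => z; apply/imsetP/imsetP => [[x _ ->]|[_ /imsetP[x _ ->] ->]].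
  by exists (fingraph.root (adj A) x); rewrite ?rr // imset_f.
by exists x; rewrite ?rr.
Qed.

(** Only the component of [b] can get lost: on the other old roots, passing to the new root is
    injective. *)
Lemma card_component_roots_setU1 A a b :
  (#|component_roots A| <= #|component_roots ([set a; b]%SET |: A)|.+1)%N.
Proof.
set A' := _ |: A.
have inj : {in component_roots A :\ fingraph.root (adj A) b &, injective (fingraph.root (adj A'))}.
  move=> z1 z2; rewrite !in_setD1 => /andP[n1 /imsetP[x1 _ E1]] /andP[n2 /imsetP[x2 _ E2]].
  have r1 : fingraph.root (adj A) z1 = z1 by rewrite E1 root_root //; exact: connect_adj_sym.
  have r2 : fingraph.root (adj A) z2 = z2 by rewrite E2 root_root //; exact: connect_adj_sym.
  move=> /(fingraph.rootP (connect_adj_sym A')); rewrite connect_adj_setU1.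
  case/or3P => [c|/andP[_ c]|/andP[c _]];
    move/(fingraph.rootP (connect_adj_sym A)): c.
  - by rewrite r1 r2.
  - by rewrite r2 => E; rewrite E eqxx in n2.
  - by rewrite r1 => E; rewrite E eqxx in n1.
rewrite (cardsD1 (fingraph.root (adj A) b)) imset_f // add1n ltnS.
rewrite -(card_in_imset inj) component_roots_setU1.
exact/subset_leq_card/finset.imsetS/finset.subsetDl.
Qed.

(** The old roots of [a] and [b] get the same new root, so that of [b] can be left out without
    changing the image. *)
Lemma card_component_roots_merge A a b :
  ~~ connect (adj A) a b ->
  (#|component_roots ([set a; b]%SET |: A)| < #|component_roots A|)%N.
Proof.
set A' := _ |: A => nab.
rewrite [ltnRHS](cardsD1 (fingraph.root (adj A) b)) imset_f // add1n ltnS.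
have -> : component_roots A' =
    [set fingraph.root (adj A') x | x in component_roots A :\ fingraph.root (adj A) b]%SET.
  rewrite component_roots_setU1; apply/eqP; rewrite finset.eqEsubset.
  rewrite (finset.imsetS _ (finset.subsetDl _ _)) andbT.
  apply/fintype.subsetP => _ /imsetP[x xA ->].
  case: (eqVneq x (fingraph.root (adj A) b)) => [->|nx]; last by rewrite imset_f // in_setD1 nx.
  apply/imsetP; exists (fingraph.root (adj A) a).
    rewrite in_setD1 imset_f // andbT; apply: contra nab => /eqP E.
    exact/(fingraph.rootP (connect_adj_sym A)).
  apply/(fingraph.rootP (connect_adj_sym A')); rewrite connect_adj_setU1.
  rewrite [connect _ (fingraph.root _ b) b]connect_adj_sym !connect_root.
  by rewrite !orbT.
exact: leq_imset_card.
Qed.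

Definition is_edge (e : {set G}) : Prop := exists a b, e = [set a; b]%SET.

Lemma card_component_roots_setU A D : (forall e, e \in D -> is_edge e) ->
  (#|component_roots A| <= #|component_roots (D :|: A)| + #|D|)%N.
Proof.
move: {2}#|D| (leqnn #|D|) => n; elim: n D => [|n IH] D.
  by rewrite leqn0 => /eqP/cards0_eq -> _; rewrite finset.set0U leq_addr.
case: (set_0Vmem D) => [-> _ _|[e eD]]; first by rewrite finset.set0U leq_addr.
rewrite (cardsD1 e) eD add1n ltnS => Dn De.
have [a [b Ee]] := De _ eD.
apply: leq_trans (IH _ Dn _) _; first by move=> e'; rewrite in_setD1 => /andP[_ /De].
rewrite addnS -addSn leq_add2r.
have := card_component_roots_setU1 (D :\ e :|: A) a b.
by rewrite -Ee finset.setUA finset.setD1K.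
Qed.

Definition bridge A (e : {set G}) : Prop :=
  exists a b, e = [set a; b]%SET /\ ~~ connect (adj (A :\ e)) a b.

(** The edges of [D] are added one at a time; a bridge of the final graph joins two different
    components at every stage. *)
Lemma card_component_roots_bridges A D : [disjoint A & D] ->
  (forall e, e \in D -> bridge (D :|: A) e) ->
  (#|component_roots (D :|: A)| + #|D| <= #|component_roots A|)%N.
Proof.
move: {2}#|D| (leqnn #|D|) => n; elim: n D => [|n IH] D.
  by rewrite leqn0 => /eqP/cards0_eq -> _; rewrite finset.set0U cards0 addn0.
case: (set_0Vmem D) => [-> _ _|[e eD]]; first by rewrite finset.set0U cards0 addn0.
rewrite (cardsD1 e) eD add1n ltnS => Dn dis De.
have eA : e \notin A by rewrite fintype.disjoint_sym in dis; rewrite (disjointFr dis eD).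
have [a [b [Ee nab]]] := De _ eD.
apply: leq_trans (IH _ Dn _ _); last first.
- move=> e'; rewrite in_setD1 => /andP[_ /De[a' [b' [-> nc]]]].
  exists a', b'; split => //; apply: contra nc; apply: connect_sub => u v uv.
  by apply/connect1/(sub_adj _ uv)/finset.setSD/finset.setSU/finset.subsetDl.
- by apply: disjointWr dis; apply: finset.subsetDl.
rewrite addnS -addSn leq_add2r.
have -> : D :|: A = [set a; b]%SET |: (D :\ e :|: A) by rewrite -Ee finset.setUA finset.setD1K.
apply: card_component_roots_merge; apply: contra nab; apply: connect_sub => u v.
rewrite /adj !inE => /orP[/andP[ne uvD]|uvA]; apply: connect1; rewrite /adj !inE.
  by rewrite ne uvD.
rewrite uvA orbT andbT; apply: contraNneq eA => <-.
by [].
Qed.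

(** Removing [T :\: T'] from the connected [T] leaves at most [#|T :\: T'| + 1] components; each
    bridge in [D] then merges two, and at least one component remains. *)
Lemma card_bridges_le T T' D : connected_by T -> T' \subset T ->
  (forall e, e \in T -> is_edge e) -> [disjoint T' & D] ->
  (forall e, e \in D -> bridge (D :|: T') e) -> (#|D| <= #|T :\: T'|)%N.
Proof.
move=> /forallP cT sT Te dis bD.
have h1 := card_component_roots_bridges dis bD.
have h2 : (#|component_roots T'| <= #|component_roots T| + #|T :\: T'|)%N.
  have -> : T = T :\: T' :|: T'.
    by rewrite finset.setUC -{1}(finset.setIidPr sT) finset.setID.
  have -> : (T :\: T' :|: T') :\: T' = T :\: T'.
    by rewrite finset.setDUl finset.setDv finset.setU0 finset.setDDl finset.setUid.
  by apply: card_component_roots_setU => e; rewrite inE => /andP[_ /Te].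
case: (set_0Vmem D) => [->|[e eD]]; first by rewrite cards0.
have [a _] := bD e eD.
have h3 : (#|component_roots T| <= 1)%N.
  rewrite (_ : component_roots T = [set fingraph.root (adj T) a]%SET) ?cards1 //.
  apply/setP => z; rewrite inE; apply/imsetP/eqP => [[x _ ->]|->]; last by exists a.
  apply/(fingraph.rootP (connect_adj_sym T)); exact: (forallP (cT x)).
have h4 : (0 < #|component_roots (D :|: T')|)%N.
  by apply/card_gt0P; exists (fingraph.root (adj (D :|: T')) a); rewrite imset_f.
lia.
Qed.

End Walks.

(** * Charged edges and the spanning tree *)

Section Charged.
Variables (R : realType) (G : wgraph R).
Implicit Types (x y z a c d : G) (p q h : seq G) (A D T H : {set {set G}}).
Implicit Types (bs : seq (G * G)).

(** In [bs] the latest pair comes first, as in histories; the second entry of a pair is the newly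
    explored end. *)
Definition visited h bs : seq G := [seq b.2 | b <- bs] ++ h.

(** What the weight bound needs of a run: each charged edge was an unblocked boundary edge at its
    time. Walks and the nesting of calls are forgotten. *)
Fixpoint greedy (delta : R) h bs : Prop :=
  if bs is (y, x) :: bs' then
    [/\ boundary (explored (visited h bs')) y x,
        ~ blocked delta (explored (visited h bs')) y x & greedy delta h bs']
  else True.

Lemma visited_cat h bs1 bs2 : visited h (bs1 ++ bs2) = visited (visited h bs2) bs1.
Proof. by rewrite /visited map_cat catA. Qed.

Lemma greedy_cat delta h bs1 bs2 :
  greedy delta h (bs1 ++ bs2) <-> greedy delta (visited h bs2) bs1 /\ greedy delta h bs2.
Proof.
elim: bs1 => [|[y x] bs1 IH] /=; first by split=> // -[].
by rewrite visited_cat; split => [[? ? /IH[]]|[[? ? ?] ?]]; split => //; apply/IH.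
Qed.

Lemma in_explored h z : (z \in explored h) = (z \in h).
Proof. by rewrite /explored inE. Qed.

Definition charged_edges bs : {set {set G}} :=
  [set e in [seq [set b.1; b.2]%SET | b <- bs]]%SET.

Lemma charged_edgesP bs e :
  reflect (exists2 b, b \in bs & e = [set b.1; b.2]%SET) (e \in charged_edges bs).
Proof. by rewrite inE; apply: mapP. Qed.

Lemma charged_edges_sub delta h bs :
  greedy delta h bs -> charged_edges bs \subset @graph_edges R G.
Proof.
move=> gr; apply/fintype.subsetP => e /charged_edgesP[[y x] yx ->] /=.
elim: bs gr yx => [|[y' x'] bs IH] //= [[e' _ _] _ gr].
rewrite inE => /orP[/eqP[-> ->]|]; last exact: IH.
by have := adj_graph_edges y' x'; rewrite /adj e'.
Qed.

Lemma greedy_visited delta h bs b :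
  greedy delta h bs -> b \in bs -> (b.1 \in visited h bs) && (b.2 \in visited h bs).
Proof.
elim: bs => [|[y x] bs IH] //= [[_ yv _] _ gr].
rewrite inE => /orP[/eqP ->|/(IH gr)] /=; rewrite /visited /= !inE.
  by move: yv; rewrite in_explored => ->; rewrite eqxx orbT.
by case/andP => -> ->; rewrite !orbT.
Qed.

Lemma charged_edges_cons b bs :
  charged_edges (b :: bs) = [set b.1; b.2]%SET |: charged_edges bs.
Proof. by apply/setP => e; rewrite !inE. Qed.

(** No edge is charged twice, because its far end was unexplored when it was charged. *)
Lemma total_weight_charged delta h bs : greedy delta h bs ->
  total_weight (charged_edges bs) = \sum_(b <- bs) weight b.1 b.2.
Proof.
rewrite /total_weight; elim: bs => [|[y x] bs IH] gr.
  by rewrite big_nil big_pred0 // => e; rewrite inE.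
rewrite big_cons charged_edges_cons /=; case: gr => [[eyx yv xv] _ gr].
rewrite big_setU1 /= ?IH ?edge_weightE //.
apply/negP => /charged_edgesP[b bb E].
have /andP[b1 b2] := greedy_visited gr bb.
by move: xv; rewrite in_explored; case/set2_eq: E => [][_ ->]; rewrite ?b1 ?b2.
Qed.

(** The closing edge is singled out: the whole cycle weighs at most [2 + delta] times the edge
    [a b]. *)
Definition short_cycle (delta : R) H a b q : Prop :=
  [/\ adj H a b, path (adj (H :\ [set a; b]%SET)) a q, last a q = b, uniq (a :: q)
    & walk_length a q <= (1 + delta) * weight a b].

Section ShortCycles.
Variables (delta : R) (H : {set {set G}}).
Hypotheses (delta_ge0 : 0 <= delta) (HG : H \subset @graph_edges R G).

Let He : subrel (adj H) (@edge R G) := sub_adj_edge HG.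

Lemma short_cycle_walk a b p : adj H a b ->
  path (adj (H :\ [set a; b]%SET)) a p -> last a p = b ->
  walk_length a p <= (1 + delta) * weight a b ->
  exists q, short_cycle delta H a b q.
Proof.
move=> ab pp lp wp.
have se : subrel (adj (H :\ [set a; b]%SET)) (@edge R G).
  by move=> u v /(sub_adj (finset.subsetDl _ _)); exact: He.
have [q [pq lq uq wq]] := walk_shorten se pp.
by exists q; split => //; rewrite ?lq //; apply: le_trans wp.
Qed.

Lemma short_cycle_sym a b q : short_cycle delta H a b q ->
  exists q', short_cycle delta H b a q'.
Proof.
case=> ab pq lq uq wq; apply: (@short_cycle_walk b a (rev (belast a q))).
- by rewrite adj_sym.
- by rewrite finset.setUC -{2}lq; apply: path_adj_rev.
- by rewrite -{1}lq last_rev_last.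
- have -> : weight b a = weight a b by rewrite weight_sym // edge_sym He.
  rewrite -{1}lq walk_length_rev //.
  by apply: sub_path pq => u v /(sub_adj (finset.subsetDl _ _)); exact: He.
Qed.

(** The cycle keeps its total weight, so it is also short with respect to any of its edges that is
    at least as heavy as the old closing edge. *)
Lemma short_cycle_rotate a b q1 d q2 : short_cycle delta H a b (q1 ++ d :: q2) ->
  weight a b <= weight (last a q1) d ->
  exists q', short_cycle delta H (last a q1) d q'.
Proof.
set c := last a q1; case=> ab; rewrite cat_path last_cat /= -/c.
case/and3P=> pq1 cd pq2 lq uq wq le.
have sH := finset.subsetDl H [set [set a; b]%SET]%SET.
have edc : edge c d by apply/He/(sub_adj sH).
have uq1 : d \notin a :: q1.
  move: uq; rewrite -/(uniq (a :: (q1 ++ d :: q2))) -cat_cons cat_uniq => /and3P[_ /hasPn hn _].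
  by apply: hn; rewrite mem_head.
have uq2 : c \notin d :: q2.
  move: uq; rewrite -/(uniq (a :: (q1 ++ d :: q2))) -cat_cons cat_uniq => /and3P[_ /hasPn hn _].
  by apply/negP => /hn /=; rewrite mem_last.
have [] // := @short_cycle_walk d c (q2 ++ a :: q1).
- by rewrite adj_sym; exact: (sub_adj sH).
- rewrite cat_path /= lq; apply/and3P; split.
  + by rewrite finset.setUC; apply: path_adj_avoid uq2; apply: sub_path pq2; exact: sub_adj.
  + rewrite /adj in_setD1 finset.setUC; apply/andP; split; last exact: ab.
    apply/eqP => E; move: cd; rewrite /adj in_setD1 => /andP[/eqP + _].
    by rewrite E finset.setUC.
  + by apply: path_adj_avoid uq1; apply: sub_path pq1; exact: sub_adj.
- by rewrite last_cat.
- rewrite walk_length_cat /= lq.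
  move: wq; rewrite walk_length_cat /= -/c.
  have -> : weight b a = weight a b by rewrite weight_sym // edge_sym He.
  have -> : weight d c = weight c d by rewrite weight_sym // edge_sym.
  have : delta * weight a b <= delta * weight c d by rewrite ler_wpM2l.
  lra.
by move=> q' /short_cycle_sym.
Qed.

End ShortCycles.

Definition tie_broken_mst D T : Prop :=
  [/\ T \subset @graph_edges R G, connected_by T,
      (forall T', T' \subset @graph_edges R G -> connected_by T' ->
         total_weight T <= total_weight T')
    & (forall T', T' \subset @graph_edges R G -> connected_by T' ->
         total_weight T' <= total_weight T -> (#|T :\: D| <= #|T' :\: D|)%N)].

Lemma tie_broken_mst_exists D : connected_graph G -> exists T, tie_broken_mst D T.
Proof.
move=> cG.
pose P T := (T \subset @graph_edges R G) && connected_by T.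
have PE : P (@graph_edges R G).
  rewrite /P subxx; apply/forallP => x; apply/forallP => y.
  by rewrite (eq_connect (@adj_graph_edges R G)) cG.
case: (@arg_minP _ _ _ _ P (@total_weight R G) PE) => T0 PT0 minT0.
pose P' T := P T && (total_weight T <= total_weight T0).
have PT0' : P' T0 by rewrite /P' PT0 lexx.
case: (@fintype.arg_minnP _ _ P' (fun T => #|T :\: D|) PT0') => T /andP[/andP[sT cT] wT] minT.
exists T; split => //.
  by move=> T' sT' cT'; apply: le_trans wT _; apply: minT0; rewrite /P sT'.
by move=> T' sT' cT' wT'; apply: minT; rewrite /P' /P sT' cT' (le_trans wT').
Qed.

Lemma total_weight_setD1 A e : e \in A ->
  total_weight A = edge_weight e + total_weight (A :\ e).
Proof. by move=> eA; rewrite /total_weight (big_setD1 e). Qed.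

(* A heaviest short cycle cannot have its heaviest edge in [T] only: exchanging
   it against an edge of the cycle crossing the cut would give a spanning tree
   with a larger intersection with [D]. *)
Lemma exchange D T a b q :
  D \subset @graph_edges R G -> tie_broken_mst D T -> adj T a b ->
  path (adj ((T :|: D) :\ [set a; b]%SET)) a q -> last a q = b ->
  (forall q1 d q2, q = q1 ++ d :: q2 -> weight (last a q1) d <= weight a b) ->
  adj D a b.
Proof.
move=> sD [sT cT minw minD] ab pq lq maxw.
apply: contraPT isT => nD.
set g := [set a; b]%SET in pq.
have eab : edge a b := sub_adj_edge sT ab.
pose T1 := T :\ g.
have sT1 : T1 \subset @graph_edges R G := fintype.subset_trans (finset.subsetDl _ _) sT.
have conn T' : T1 \subset T' -> connect (adj T') a b -> connected_by T'.
  move=> s1 cab; apply/forallP => x; apply/forallP => y.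
  apply: connect_sub (forallP (forallP cT x) y) => u v uv.
  case: (eqVneq [set u; v]%SET g) => [/set2_eq[][-> ->]|ng] //.
    by rewrite connect_adj_sym.
  by apply/connect1/(sub_adj s1); rewrite /adj in_setD1 ng.
have cardD T' (f : {set G}) : T' = T1 \/ (f \in D /\ T' = f |: T1) -> (#|T' :\: D| < #|T :\: D|)%N.
  move=> hT'; apply: (@leq_ltn_trans #|(T :\: D) :\ g|); last first.
    by rewrite [ltnRHS](cardsD1 g) inE nD [_ \in T]ab add1n ltnS.
  apply/subset_leq_card/fintype.subsetP => e.
  case: hT' => [->|[hD ->]]; rewrite !inE; first by case/and3P => -> -> ->.
  case/andP => eD /orP[/eqP Eh|/andP[-> ->]]; last by rewrite eD.
  by rewrite Eh hD in eD.
(* If the edge lies on a cycle of [T], dropping it already contradicts the choice of [T]. *)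
case: (boolP (connect (adj T1) a b)) => [cab|ncab].
  have := cardD T1 g (or_introl erefl); rewrite ltnNge minD ?conn //.
  by rewrite (total_weight_setD1 ab) lerDr edge_weight_ge0.
have := first_exit (P := fun z => connect (adj T1) a z) pq (connect0 _ _).
rewrite lq => /(_ (negP ncab)) [q1 [d [q2 [Eq cq1 nd]]]].
set c := last a q1; have cc : connect (adj T1) a c by apply: cq1; exact: mem_last.
rewrite /adj in_setD1 finset.in_setU => /andP[ng TD].
have nT : [set c; d]%SET \notin T.
  apply/negP => cdT; apply: nd; apply: connect_trans cc _; apply: connect1.
  by rewrite /adj in_setD1 ng.
have hD : [set c; d]%SET \in D by rewrite (negbTE nT) in TD.
have ecd : edge c d := sub_adj_edge sD hD.
pose T2 := [set c; d]%SET |: T1.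
have sT2 : T2 \subset @graph_edges R G.
  by rewrite finset.subUset sT1 andbT finset.sub1set (fintype.subsetP sD).
have cT2 : connected_by T2.
  apply: conn; first exact: finset.subsetUr.
  rewrite connect_adj_setU1 cc /=; apply/orP; right; apply/orP; left.
  have := @connect_adj_setD1 R G T a b d (forallP (forallP cT a) d).
  by rewrite -/g -/T1 => /orP[//|]; rewrite connect_adj_sym.
have wT2 : total_weight T2 <= total_weight T.
  rewrite (total_weight_setD1 ab) (@total_weight_setD1 T2 [set c; d]%SET) ?finset.setU11 //.
  rewrite finset.setU1K; last by rewrite in_setD1 (negbTE nT) andbF.
  by rewrite !edge_weightE // lerD2r; apply: maxw Eq.
have := cardD T2 [set c; d]%SET (or_intror (conj hD erefl)).
by rewrite ltnNge minD.
Qed.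

Lemma first_in_seq (X : eqType) (P : X -> Prop) (s : seq X) (x : X) :
  x \in s -> P x -> exists (s1 : seq X) (y : X) (s2 : seq X),
  [/\ s = s1 ++ y :: s2, P y & forall z : X, z \in s1 -> ~ P z].
Proof.
elim: s => [|t s IH] //; rewrite inE => xs Px.
case: (pselect (P t)) => Pt; first by exists [::], t, s; split.
case/orP: xs => [/eqP E|xs]; first by rewrite -E in Pt.
have [s1 [y [s2 [-> Py ns1]]]] := IH xs Px.
exists (t :: s1), y, s2; split => // z; rewrite inE => /orP[/eqP -> //|]; exact: ns1.
Qed.

(* Take a short cycle whose closing edge is heaviest and, among these, charged
   last. Walking around the cycle from that edge, the first edge leaving the
   explored set would have blocked it. *)
Lemma no_short_cycle delta v bs T a b q :
  0 <= delta -> greedy delta [:: v] bs -> tie_broken_mst (charged_edges bs) T ->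
  ~ short_cycle delta (T :|: charged_edges bs) a b q.
Proof.
move=> d0 gr mst; set D := charged_edges bs; set H := T :|: D.
move=> sc0.
have sD : D \subset @graph_edges R G := charged_edges_sub gr.
have sT : T \subset @graph_edges R G by case: mst.
have sH : H \subset @graph_edges R G by rewrite finset.subUset sT.
pose P (p : G * G) := `[< exists q, short_cycle delta H p.1 p.2 q >].
have Pab : P (a, b) by apply/asboolP; exists q.
case: (@arg_maxP _ _ _ _ P (fun p : G * G => weight p.1 p.2) Pab) => -[am bm] /asboolP/= [qm scm] maxP.
set M := weight am bm in maxP.
have maxM u w : (exists q', short_cycle delta H u w q') -> weight u w <= M.
  by move=> h; apply: (maxP (u, w)); apply/asboolP.
have cyc u w q' q1 d q2 : short_cycle delta H u w q' -> weight u w = M ->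
    q' = q1 ++ d :: q2 -> weight (last u q1) d <= M.
  move=> sc wM Eq; rewrite leNgt; apply/negP => lt.
  have : exists q3, short_cycle delta H (last u q1) d q3.
    apply: (@short_cycle_rotate delta H d0 sH u w q1 d q2); first by rewrite -Eq.
    by rewrite wM ltW.
  by move/maxM; rewrite leNgt lt.
have inD u w q' : short_cycle delta H u w q' -> weight u w = M -> [set u; w]%SET \in D.
  move=> sc wM; case: (sc) => uw pq lq _ _.
  move: (uw); rewrite /adj finset.in_setU => /orP[uwT|//].
  apply: (exchange sD mst uwT pq lq) => q1 d q2 Eq.
  by rewrite wM; apply: cyc sc wM Eq.
pose Q (p : G * G) := weight p.1 p.2 = M /\ exists q', short_cycle delta H p.1 p.2 q'.
have [[y x] yxbs Qyx] : exists2 p : G * G, p \in bs & Q p.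
  have /charged_edgesP[[y x] yxbs /= E] := inD _ _ _ scm erefl.
  exists (y, x) => //; case/set2_eq: E => [][E1 E2]; subst; split => //=; first by exists qm.
    by rewrite -weight_sym //; case: scm => /(sub_adj_edge sH).
  exact: short_cycle_sym scm.
(* The latest charge comes first in [bs], so this picks the edge charged last among those of maximal
   weight [M]. *)
have [bs1 [[y1 x1] [bs2 [Ebs [/= wM [q1 sc]] nbs1]]]] := first_in_seq yxbs Qyx.
have /greedy_cat [_ /= [[e1 y1S x1S] nbl gr2]] : greedy delta [:: v] (bs1 ++ (y1, x1) :: bs2).
  by rewrite -Ebs.
set S := explored _ in y1S x1S nbl.
case: (sc) => yx1 pq lq uq wq.
have := first_exit (P := fun z => z \in S) pq y1S.
rewrite lq => /(_ (negP x1S)) [p1 [d [p2 [Eq Sp1 /negP dS ed]]]].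
set c := last y1 p1 in ed.
have cS : c \in S by apply: Sp1; exact: mem_last.
have edc : edge c d.
  by apply: (sub_adj_edge (fintype.subset_trans (finset.subsetDl _ _) sH) ed).
have sHe u : subrel (adj (H :\ u)) (@edge R G).
  by apply/sub_adj_edge/(fintype.subset_trans (finset.subsetDl _ _)).
(* The cycle up to [d] is internally explored and no longer than [(1 + delta) * M], so an edge
   [(c, d)] lighter than [M] would block [(y1, x1)]. *)
have wcd : weight c d = M.
  apply/eqP; rewrite eq_le (cyc _ _ _ _ _ _ sc wM Eq) /= leNgt; apply/negP => lt.
  apply: nbl; exists c, d; split => //; first by rewrite wM.
  apply: ge_ereal_inf; exists (walk_length y1 (rcons p1 d))%:E; last first.
    rewrite lee_fin; apply: le_trans wq; rewrite Eq -cat_rcons [leRHS]walk_length_cat.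
    rewrite lerDl walk_length_ge0 //.
    move: pq; rewrite Eq -cat_rcons cat_path => /andP[_].
    by apply: sub_path; exact: sHe.
  exists (rcons p1 d); split => //; split.
  - move: pq; rewrite Eq -cat_rcons cat_path => /andP[+ _].
    by apply: sub_path; exact: sHe.
  - by rewrite last_rcons.
  - by move: uq; rewrite Eq -cat_rcons -cat_cons cat_uniq => /andP[].
  - by rewrite belast_rcons /=; apply/allP => z zp1; apply: Sp1; rewrite inE zp1 orbT.
have [q2 sc2] : exists q', short_cycle delta H c d q'.
  apply: (@short_cycle_rotate delta H d0 sH y1 x1 p1 d p2); first by rewrite -Eq.
  by rewrite -/c wcd wM.
have /charged_edgesP[[y2 x2] yx2 /= E] := inD _ _ _ sc2 wcd.
(* The edge [(c, d)] has weight [M] and is charged too. If later, this contradicts the choice of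
   [(y1, x1)]; it is not that edge itself, which the path avoids; if earlier, [d] would be
   explored. *)
move: yx2; rewrite Ebs mem_cat inE => /or3P[in1|/eqP[E1 E2]|in2].
- apply: (nbs1 _ in1); case/set2_eq: E => [][E1 E2]; subst; split => //=; first by exists q2.
    by rewrite -weight_sym.
  exact: short_cycle_sym sc2.
- by move: ed; rewrite /adj in_setD1 E E1 E2 eqxx.
- have /andP[y2S x2S] := greedy_visited gr2 in2.
  by move: dS; rewrite /S in_explored; case/set2_eq: E => [][_ ->]; rewrite ?y2S ?x2S.
Qed.

End Charged.

(** * Random orders and balls *)

Section RandomFirst.
Variable X : finType.
Implicit Types (s : {perm X}) (M N : {set X}) (c d : X).

(** A permutation stands for a linear order; counting permutations replaces the uniform
    probability. *)
Definition rank_in s c : nat := enum_rank (s c).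

Lemma rank_in_inj s : injective (rank_in s).
Proof. by move=> c d /val_inj/enum_rank_inj/perm_inj. Qed.

Definition comes_first s N c : bool := [forall d in N, rank_in s c <= rank_in s d]%N.

(** When [M] lies in [N], this is the event that the first element of [N] belongs to [M]. *)
Definition first_hit s N M : bool := [exists c in M, comes_first s N c].

Lemma comes_first_uniq s N c d :
  c \in N -> d \in N -> comes_first s N c -> comes_first s N d -> c = d.
Proof.
move=> cN dN /forall_inP/(_ d dN) h1 /forall_inP/(_ c cN) h2.
by apply: (@rank_in_inj s); apply/eqP; rewrite eqn_leq h1.
Qed.

(** Composing with the transposition of [c] and [d] exchanges the two events. *)
Lemma card_comes_first N c d : c \in N -> d \in N ->
  #|[set s | comes_first s N c]%SET| = #|[set s | comes_first s N d]%SET|.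
Proof.
move=> cN dN; rewrite -(card_imset _ (mulgI (tperm c d))).
apply: eq_card => s; rewrite inE; apply/imsetP/forall_inP.
  move=> [t]; rewrite inE => /forall_inP ht -> x xN.
  rewrite /rank_in !permM tpermR.
  have := ht (tperm c d x); rewrite /rank_in; apply.
  by case: tpermP => // ->.
move=> hs; exists (tperm c d * s)%g; last by rewrite mulgA tperm2 mul1g.
rewrite inE; apply/forall_inP => x xN.
rewrite /rank_in !permM tpermL.
have := hs (tperm c d x); rewrite /rank_in; apply.
by case: tpermP => // ->.
Qed.

Lemma sum_comes_first s N : N != finset.set0 ->
  (\sum_(c in N) comes_first s N c = 1)%N.
Proof.
case/set0Pn => c0 c0N.
case: (@fintype.arg_minnP _ c0 (mem N) (rank_in s) c0N) => c cN minc.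
have cf : comes_first s N c by apply/forall_inP => d dN; apply: minc.
rewrite (bigD1 c) //= cf big1 // => d /andP[dN dc].
by apply/eqP; rewrite eqb0; apply: contra dc => df; apply/eqP/(comes_first_uniq dN cN df cf).
Qed.

(** The elements of [N] are equally likely to come first. The probability [#|M| / #|N|] is stated by
    cross-multiplication, in natural numbers. *)
Lemma card_first_hit N M : M \subset N ->
  (#|[set s | first_hit s N M]%SET| * #|N| = #|M| * #|{perm X}|)%N.
Proof.
move=> sMN; case: (set_0Vmem N) => [N0|[c0 c0N]].
  by move: sMN; rewrite N0 finset.subset0 => /eqP ->; rewrite !cards0 muln0.
have nN : N != finset.set0 by apply/set0Pn; exists c0.
pose k := #|[set s | comes_first s N c0]%SET|.
have tot : (#|N| * k = #|{perm X}|)%N.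
  rewrite -[RHS]sum1_card -sum_nat_const.
  rewrite (eq_bigr (fun c => \sum_s comes_first s N c)%N); last first.
    by move=> c cN; rewrite /k (card_comes_first c0N cN) cardsE -sum1_card big_mkcond.
  by rewrite exchange_big /=; apply: eq_bigr => s _; rewrite sum_comes_first.
suff -> : #|[set s | first_hit s N M]%SET| = (#|M| * k)%N by rewrite -tot; lia.
rewrite -sum_nat_const cardsE -sum1_card big_mkcond /=.
rewrite [RHS](eq_bigr (fun c => \sum_s comes_first s N c)%N); last first.
  move=> c cM; rewrite /k (card_comes_first c0N (fintype.subsetP sMN _ cM)).
  by rewrite cardsE -sum1_card big_mkcond.
rewrite exchange_big /=; apply: eq_bigr => s _.
rewrite [_ \in _]/(first_hit s N M); case: ifP => [/exists_inP[c cM cf]|/negbT].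
  rewrite (bigD1 c) //= cf big1 // => d /andP[dM dc].
  apply/eqP; rewrite eqb0; apply: contra dc => df.
  by apply/eqP/(comes_first_uniq _ _ df cf); apply: (fintype.subsetP sMN).
rewrite negb_exists_in => /forall_inP nf.
by rewrite big1 // => c /nf/negbTE ->.
Qed.

End RandomFirst.

(** * Distances within an edge set *)

Section Near.
Variables (R : realType) (G : wgraph R).
Implicit Types (x y z a c d : G) (p q : seq G) (A H : {set {set G}}) (r s : R).

Definition near A r c x : bool :=
  `[< exists p, [/\ path (adj A) c p, last c p = x & walk_length c p <= r] >].

Lemma near_refl A r c : 0 <= r -> near A r c c.
Proof. by move=> r0; apply/asboolP; exists [::]. Qed.

Lemma near_le A A' r s c x : A \subset A' -> r <= s -> near A r c x -> near A' s c x.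
Proof.
move=> sA rs /asboolP[p [pp lp wp]]; apply/asboolP; exists p; split => //.
  by apply: sub_path pp; exact: sub_adj.
exact: le_trans rs.
Qed.

Lemma near_trans A r s x y z : near A r x y -> near A s y z -> near A (r + s) x z.
Proof.
move=> /asboolP[p [pp lp wp]] /asboolP[q [pq lq wq]]; apply/asboolP.
exists (p ++ q); rewrite cat_path last_cat walk_length_cat lp pp pq lq; split => //.
exact: lerD.
Qed.

Lemma near_edge A x y : adj A x y -> near A (weight x y) x y.
Proof. by move=> xy; apply/asboolP; exists [:: y]; rewrite /= xy addr0. Qed.

Lemma near_sym A r x y : A \subset @graph_edges R G -> near A r x y -> near A r y x.
Proof.
move=> sA /asboolP[p [pp lp wp]]; apply/asboolP; exists (rev (belast x p)).
rewrite -lp path_adj_rev // last_rev_last walk_length_rev //.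
by apply: sub_path pp; exact: sub_adj_edge.
Qed.

Lemma near_prefix A r c p z : A \subset @graph_edges R G -> path (adj A) c p ->
  walk_length c p <= r -> z \in c :: p -> near A r c z.
Proof.
move=> sA pp wp zp; case/splitPl: zp pp wp => p1 p2 lp1.
rewrite cat_path walk_length_cat => /andP[pp1 pp2] wp.
apply/asboolP; exists p1; split => //; apply: le_trans wp; rewrite lerDl.
by apply: walk_length_ge0; apply: sub_path pp2; exact: sub_adj_edge.
Qed.

(** Every vertex on a walk of length at most [r] is near its start, so a walk witnessing nearness
    cannot pass through [z]. *)
Lemma near_avoid A r c x z z' : A \subset @graph_edges R G ->
  near A r c x -> ~~ near A r c z -> near (A :\ [set z; z']%SET) r c x.
Proof.
move=> sA /asboolP[p [pp lp wp]] nz; apply/asboolP; exists p; split => //.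
by apply: path_adj_avoid => //; apply: contra nz => zp; apply: (near_prefix sA pp wp zp).
Qed.

(** A simple path uses the edge at most once, in one of its two directions. *)
Lemma path_split_edge A a b c p : path (adj A) c p -> uniq (c :: p) ->
  let A' := A :\ [set a; b]%SET in
  [\/ path (adj A') c p,
      exists p1 p2, [/\ p = p1 ++ b :: p2, last c p1 = a, path (adj A') c p1
        & path (adj A') b p2]
    | exists p1 p2, [/\ p = p1 ++ a :: p2, last c p1 = b, path (adj A') c p1
        & path (adj A') a p2]].
Proof.
move=> pp up A'; elim: p c pp up => [|y p IH] c //=; first by move=> _ _; apply: Or31.
case/andP => cy pp /andP[cyp up].
case: (eqVneq [set c; y]%SET [set a; b]%SET) => [/set2_eq[][Ec Ey]|nE].
- apply: Or32; exists [::], p; subst; split => //; exact: path_adj_avoid.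
- apply: Or33; exists [::], p; subst; split => //.
  by rewrite /A' finset.setUC; exact: path_adj_avoid.
have cy' : adj A' c y by rewrite /adj in_setD1 nE.
case: (IH y pp up) => [pA'|[p1 [p2 [-> l1 pA1 pA2]]]|[p1 [p2 [-> l1 pA1 pA2]]]].
- by apply: Or31; rewrite cy'.
- by apply: Or32; exists (y :: p1), p2; split => //=; rewrite cy'.
- by apply: Or33; exists (y :: p1), p2; split => //=; rewrite cy'.
Qed.

Lemma near_split_edge A a b r c x : A \subset @graph_edges R G -> near A r c x ->
  let A' := A :\ [set a; b]%SET in
  [\/ near A' r c x, near A' r c a /\ near A' r b x | near A' r c b /\ near A' r a x].
Proof.
move=> sA /asboolP[p0 [pp0 lp0 wp0]] A'.
have sA' : A' \subset @graph_edges R G := fintype.subset_trans (finset.subsetDl _ _) sA.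
have [p [pp lp up wp]] := walk_shorten (sub_adj_edge sA) pp0.
rewrite {}lp0 in lp; have {}wp := le_trans wp wp0.
have aux u w p1 p2 : p = p1 ++ w :: p2 -> last c p1 = u -> path (adj A') c p1 ->
    path (adj A') w p2 -> near A' r c u /\ near A' r w x.
  move=> Ep l1 pA1 pA2.
  have w1 := walk_length_ge0 (sub_path (sub_adj_edge sA') pA1).
  have w2 := walk_length_ge0 (sub_path (sub_adj_edge sA') pA2).
  move: pp lp wp; rewrite Ep cat_path last_cat walk_length_cat /= l1 => /and3P[_ uw _] lx.
  have w3 := weight_ge0 (sub_adj_edge sA uw).
  move=> wp; split; apply/asboolP; first by exists p1; split => //; lra.
  by exists p2; split => //; lra.
have := @path_split_edge A a b c p pp up.
case=> [pA'|[p1 [p2 [Ep l1 pA1 pA2]]]|[p1 [p2 [Ep l1 pA1 pA2]]]].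
- by apply: Or31; apply/asboolP; exists p.
- exact/Or32/(aux _ _ p1 p2).
- exact/Or33/(aux _ _ p1 p2).
Qed.

(** * Balls in a graph without short cycles *)

Section Girth.
Variables (delta : R) (H : {set {set G}}).
Hypotheses (delta_ge0 : 0 <= delta) (HG : H \subset @graph_edges R G).
Hypothesis girth : forall a b q, ~ short_cycle delta H a b q.

Lemma far_ends a b r : adj H a b -> r <= (1 + delta) * weight a b ->
  ~~ near (H :\ [set a; b]%SET) r a b.
Proof.
move=> ab rw; apply/negP => /asboolP[p [pp lp wp]].
have [q] := short_cycle_walk HG ab pp lp (le_trans wp rw).
exact: girth.
Qed.

(** Here [c] reaches [a], but not [b], without the edge [a b]. Where the path first leaves the ball
    around [c] in [H'], its edge [y y'] lies with [a b] on a closed walk through [c]; the heavier of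
    the two edges then closes a short cycle. *)
Lemma ball_bridge_aux A a b c r W p :
  let H' := H :\ [set a; b]%SET in
  A \subset H -> adj H a b -> 0 <= r -> 0 <= W -> W <= weight a b -> 3 * r <= delta * W ->
  near H' r c a -> ~~ near H' r c b ->
  path (adj (A :\ [set a; b]%SET)) a p -> last a p = b ->
  (forall z, z \in a :: p -> near H r c z) -> False.
Proof.
move=> H' sA ab r0 W0 Ww rW ca ncb pp lp nearp.
have sH' : H' \subset @graph_edges R G := fintype.subset_trans (finset.subsetDl _ _) HG.
have sH'H f : H' :\ f \subset H :\ f by apply/finset.setSD/finset.subsetDl.
have dW : delta * W <= delta * weight a b by rewrite ler_wpM2l.
have := first_exit (P := fun z => near H' r c z) pp ca.
rewrite lp => /(_ (negP ncb)) [p1 [y' [p2 [Ep np1 /negP ny' yy']]]].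
have cy' : near H r c y' by apply: nearp; rewrite Ep -cat_cons mem_cat mem_head orbT.
have cy := np1 _ (mem_last _ _).
move: yy' cy; move: (last a p1) => y yy' cy.
(* Within distance [r], [c] reaches [y'] only across the edge from [a] to [b]. *)
have by' : near H' r b y'.
  case: (@near_split_edge H a b r c y' HG cy') => [|[]|[]]; rewrite -/H' //.
    by rewrite (negbTE ny').
  by rewrite (negbTE ncb).
(* This keeps the walk from [b] to [y'] away from [y], and so off the edge [y y']. *)
have nby : ~~ near H' r b y.
  apply/negP => by_; have : ~~ near H' (r + (r + r)) a b by apply: far_ends => //; lra.
  by rewrite (near_trans (near_sym sH' ca) (near_trans cy (near_sym sH' by_))).
have yyH : adj H y y'.
  by apply: (sub_adj _ yy'); apply: fintype.subset_trans sA; exact: finset.subsetDl.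
have nE : [set y; y']%SET != [set a; b]%SET.
  by move: yy'; rewrite /adj in_setD1 => /andP[].
have yyH' : adj H' y y' by rewrite /adj in_setD1 nE.
case: (leP (weight y y') (weight a b)) => ww.
  have : ~~ near H' (r + (r + (weight y y' + r))) a b by apply: far_ends => //; lra.
  rewrite (near_trans (near_sym sH' ca) (near_trans cy (near_trans (near_edge yyH') _))) //.
  exact: near_sym.
have dW2 : delta * weight a b <= delta * weight y y' by rewrite ler_wpM2l // ltW.
have : ~~ near (H :\ [set y; y']%SET) (r + (r + (weight a b + r))) y y'.
  by apply: far_ends => //; lra.
have sHf : H :\ [set y; y']%SET \subset @graph_edges R G :=
  fintype.subset_trans (finset.subsetDl _ _) HG.
have avoid1 x : near H' r c x -> near (H :\ [set y; y']%SET) r c x.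
  move=> cx; rewrite finset.setUC; apply: near_le (sH'H _) (lexx r) _.
  exact: near_avoid.
rewrite (near_trans (near_sym sHf (avoid1 _ cy)) (near_trans (avoid1 _ ca) (near_trans (near_edge _) _))) //.
  by rewrite /adj in_setD1 eq_sym nE.
by apply: near_le (sH'H _) (lexx r) _; exact: near_avoid.
Qed.

(* Inside a ball of radius at most [delta * W / 3], an edge of weight at least
   [W] lies on no cycle: two shortest paths to the center would close a short
   cycle. *)
Lemma ball_bridge A a b c r W p :
  A \subset H -> adj H a b -> 0 <= r -> 0 <= W -> W <= weight a b -> 3 * r <= delta * W ->
  path (adj (A :\ [set a; b]%SET)) a p -> last a p = b ->
  (forall z, z \in a :: p -> near H r c z) -> False.
Proof.
move=> sA ab r0 W0 Ww rW pp lp nearp.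
set H' := H :\ [set a; b]%SET.
have sH' : H' \subset @graph_edges R G := fintype.subset_trans (finset.subsetDl _ _) HG.
have dW : delta * W <= delta * weight a b by rewrite ler_wpM2l.
case: (boolP (near H' r c a)) => [ca|nca]; case: (boolP (near H' r c b)) => [cb|ncb].
- have : ~~ near H' (r + r) a b by apply: far_ends => //; lra.
  by rewrite (near_trans (near_sym sH' ca) cb).
- exact: (@ball_bridge_aux A a b c r W p).
- have Eab := weight_sym (sub_adj_edge HG ab).
  apply: (@ball_bridge_aux A b a c r W (rev (belast a p))) => //.
  + by rewrite adj_sym.
  + by rewrite -Eab.
  + by rewrite finset.setUC.
  + by rewrite finset.setUC.
  + by rewrite finset.setUC -{2}lp; exact: path_adj_rev.
  + by rewrite -{1}lp last_rev_last.
  + move=> z; rewrite -{1}lp -rev_rcons -lastI mem_rev; exact: nearp.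
- case: (@near_split_edge H a b r c a HG (nearp a (mem_head _ _))) => [|[]|[]];
    by rewrite -/H' ?(negbTE nca) ?(negbTE ncb).
Qed.

End Girth.
End Near.

(** * Random clustering *)

Section RealSums.
Variable R : realType.

(** The shift by [m] is made of [m] unit shifts, each telescoping; [m <= K] keeps every argument at
    least [K]. This discretizes the average over a random radius. *)
Lemma sum_shift_le (g : nat -> R) (m K : nat) : {homo g : i j / (i <= j)%N >-> i <= j} ->
  (m <= K)%N ->
  \sum_(2 * K <= k < 4 * K) (g k - g (k - m)%N) <= m%:R * (g (4 * K)%N - g K).
Proof.
move=> mg; elim: m => [|m IH] mK.
  by rewrite mul0r big1 // => k _; rewrite subn0 subrr.
rewrite -natr1 mulrDl mul1r.
rewrite (_ : \sum_(_ <= _ < _) _ = \sum_(2 * K <= k < 4 * K) (g k - g (k - m)%N) +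
    \sum_(2 * K <= k < 4 * K) (g (k - m)%N - g (k - m.+1)%N)); last first.
  by rewrite -big_split /=; apply: eq_bigr => k _; ring.
apply: lerD; first by apply: IH; lia.
rewrite (_ : \sum_(_ <= _ < _) _ = \sum_(2 * K <= k < 4 * K)
    ((fun k => g (k - m.+1)%N) k.+1 - (fun k => g (k - m.+1)%N) k)); last first.
  by apply: eq_big_nat => k hk; congr (g _ - _); lia.
rewrite telescope_sumr; last by lia.
by apply: lerB; apply: mg; lia.
Qed.

(** Jensen's inequality for [expR], from the tangent at [- c]. *)
Lemma sum_expR_ge (t : nat -> R) (a b : nat) (c : R) :
  \sum_(a <= k < b) t k <= c * (b - a)%:R ->
  (b - a)%:R * expR (- c) <= \sum_(a <= k < b) expR (- t k).
Proof.
move=> ht.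
have : \sum_(a <= k < b) expR (- c) * (1 + (c - t k)) <= \sum_(a <= k < b) expR (- t k).
  apply: ler_sum => k _.
  rewrite [X in _ <= X](_ : _ = expR (- c) * expR (c - t k)); last first.
    by rewrite -expRD; congr expR; ring.
  by rewrite ler_wpM2l ?expR_ge0 // expR_ge1Dx.
apply: le_trans; rewrite -mulr_sumr mulrC ler_wpM2l ?expR_ge0 //.
rewrite big_split /= sumrB !sumr_const_nat.
by rewrite -[c *+ _]mulr_natr; lra.
Qed.

(** Rounds a weight up to a multiple of [tau] while at most doubling it; weight 0 calls for
    [m = 0]. *)
Lemma natmul_approx (w tau : R) : 0 < tau -> w = 0 \/ tau <= w ->
  exists m : nat, w <= m%:R * tau /\ m%:R * tau <= 2 * w.
Proof.
move=> t0 [->|tw]; first by exists 0%N; rewrite mul0r; split; lra.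
have w0 : 0 <= w / tau by rewrite divr_ge0 //; lra.
exists (Num.truncn (w / tau)).+1.
have /andP[h1 h2] := truncn_itv w0.
have wE : w = w / tau * tau by rewrite divfK // gt_eqF.
split; first by rewrite {1}wE ler_wpM2r // ltW.
have : (Num.truncn (w / tau))%:R * tau <= w by rewrite {2}wE ler_wpM2r // ltW.
by rewrite -natr1; lra.
Qed.

(** The largest term is below [X] and dominates the sum of the others. *)
Lemma sum_geometric_lt (w0 X : R) (I : nat) : 0 <= w0 -> 0 <= X ->
  \sum_(i < I | w0 * 2 ^+ i < X) w0 * 2 ^+ i <= 2 * X.
Proof.
move=> h0 hX; elim: I => [|I IH]; first by rewrite big_ord0; lra.
rewrite big_mkcond big_ord_recr /= -big_mkcond /=; case: ifP => hI; last by rewrite addr0.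
have : \sum_(i < I | w0 * 2 ^+ i < X) w0 * 2 ^+ i <= w0 * 2 ^+ I.
  apply: le_trans (_ : \sum_(i < I) w0 * 2 ^+ i <= _).
    rewrite big_mkcond; apply: ler_sum => i _; case: ifP => // _.
    by rewrite mulr_ge0 // exprn_ge0.
  rewrite -mulr_sumr ler_wpM2l //.
  elim: {hI IH} I => [|I IH]; first by rewrite big_ord0 expr0.
  by rewrite big_ord_recr exprS /=; lra.
lra.
Qed.

(** Two dyadic steps are the factor 4 between the radii [delta * W / 12] and [delta * W / 3]. *)
Lemma sum_two_step (a : nat -> R) (I : nat) (M : R) : (forall i, 0 <= a i) ->
  (forall i, a i <= M) -> \sum_(i < I) (a i.+2 - a i) <= 2 * M.
Proof.
move=> a0 aM.
have -> : \sum_(i < I) (a i.+2 - a i) = a I.+1 + a I - a 1%N - a 0%N.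
  elim: I => [|I IH]; first by rewrite big_ord0; ring.
  by rewrite big_ord_recr /= IH; ring.
have := a0 0%N; have := a0 1%N; have := aM I; have := aM I.+1; lra.
Qed.

Lemma dyadic_scale (w0 w : R) (I : nat) : w0 <= w -> w < w0 * 2 ^+ I ->
  exists i : 'I_I, w0 * 2 ^+ i <= w < w0 * 2 ^+ i.+1.
Proof.
elim: I => [|I IH] h1 h2; first by move: h2; rewrite expr0; lra.
case: (ltP w (w0 * 2 ^+ I)) => h.
  by have [i hi] := IH h1 h; exists (widen_ord (leqnSn I) i).
by exists ord_max; rewrite h.
Qed.

Lemma dyadic_bound (w0 w : R) : 0 < w0 -> exists I : nat, w < w0 * 2 ^+ I.
Proof.
move=> h0; exists (Num.truncn (`|w| / w0)).+1.
have h : 0 <= `|w| / w0 by rewrite divr_ge0 // ltW.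
have /andP[_ h2] := truncn_itv h.
apply: le_lt_trans (ler_norm w) _; rewrite mulrC -ltr_pdivrMr //.
apply: lt_trans h2 _; rewrite -natrX ltr_nat; exact: ltn_expl.
Qed.

Lemma min_positive (X : finType) (f : X -> R) : (forall x, 0 <= f x) ->
  exists2 w0 : R, 0 < w0 & forall x, f x = 0 \/ w0 <= f x.
Proof.
move=> f0; case: (pickP (fun x => 0 < f x)) => [x0 fx0|none]; last first.
  exists 1 => // x; left; apply/eqP; rewrite eq_le f0 andbT leNgt.
  by rewrite none.
case: (@arg_minP _ _ _ x0 (fun x => 0 < f x) f fx0) => x fx minx.
exists (f x) => // y; have := f0 y; rewrite le_eqVlt => /orP[/eqP <-|/minx]; first by left.
by right.
Qed.

End RealSums.

(** * The clustering for one radius *)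

Section Lightness.
Variables (R : realType) (G : wgraph R) (delta : R) (T D : {set {set G}}).
Let H := T :|: D.
Hypotheses (delta_ge0 : 0 <= delta) (TG : T \subset @graph_edges R G)
  (DG : D \subset @graph_edges R G) (cT : connected_by T).
Hypothesis girth : forall a b q, ~ short_cycle delta H a b q.
Implicit Types (e f : {set G}) (F : {set {set G}}) (r t W : R) (s : {perm G}).

Let HG : H \subset @graph_edges R G.
Proof. by rewrite finset.subUset TG. Qed.

Definition hits r e : {set G} := [set c | [exists x in e, near H r c x]]%SET.
Definition covers r e : {set G} := [set c | [forall x in e, near H r c x]]%SET.
(** The first center reaching the edge reaches both ends, so both join its cluster: the edge is
    kept. *)
Definition good s r e : bool := first_hit s (hits r e) (covers r e).

Lemma graph_edgesP e : e \in @graph_edges R G -> exists a b, e = [set a; b]%SET /\ edge a b.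
Proof. by case/imsetP => -[a b] /= eab ->; exists a, b. Qed.

Lemma covers_sub_hits r e : e \in H -> covers r e \subset hits r e.
Proof.
move/(fintype.subsetP HG)/graph_edgesP => [a [b [-> _]]].
apply/fintype.subsetP => c; rewrite !finset.inE => /forall_inP/(_ a) h.
by apply/exists_inP; exists a; rewrite ?h // ?finset.inE eqxx.
Qed.

Lemma hits_le r t e : r <= t -> hits r e \subset hits t e.
Proof.
move=> rt; apply/fintype.subsetP => c; rewrite !finset.inE => /exists_inP[x xe cx].
by apply/exists_inP; exists x => //; apply: near_le cx.
Qed.

Lemma hits_sub_covers r t e : e \in H -> edge_weight e <= t ->
  hits r e \subset covers (r + t) e.
Proof.
move=> eH; have [a [b [Ee eab]]] := graph_edgesP (fintype.subsetP HG _ eH).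
move: eH; rewrite {}Ee edge_weightE // => abH wt.
have w0 := weight_ge0 eab.
have ab : near H t a b by apply: near_le (near_edge abH).
have ba := near_sym HG ab.
apply/fintype.subsetP => c; rewrite !finset.inE => /exists_inP[x xab cx].
apply/forall_inP => y; move: xab; rewrite !finset.inE.
have c1 : near H (r + t) c x by apply: near_le cx => //; lra.
case/orP => /eqP Ex; case/orP => /eqP Ey; subst x y => //.
- exact: near_trans cx ab.
- exact: near_trans cx ba.
Qed.

Lemma card_hits_gt0 r e : e \in H -> 0 <= r -> (0 < #|hits r e|)%N.
Proof.
move/(fintype.subsetP HG)/graph_edgesP => [a [b [-> _]]] r0.
apply/card_gt0P; exists a; rewrite finset.inE; apply/exists_inP; exists a.
  by rewrite !finset.inE eqxx.
exact: near_refl.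
Qed.

Definition is_center s r c x : Prop :=
  near H r c x /\ forall c', near H r c' x -> (rank_in s c <= rank_in s c')%N.

Lemma is_center_uniq s r c c' x : is_center s r c x -> is_center s r c' x -> c = c'.
Proof.
move=> [h1 h2] [h1' h2']; apply: (@rank_in_inj _ s); apply/eqP.
by rewrite eqn_leq h2 ?h2'.
Qed.

Lemma good_center s r e : good s r e -> exists c, forall x, x \in e -> is_center s r c x.
Proof.
case/exists_inP => c; rewrite finset.inE => /forall_inP cov /forall_inP first.
exists c => x xe; split; first exact: cov.
by move=> c' c'x; apply: first; rewrite finset.inE; apply/exists_inP; exists x.
Qed.

(** A cycle of kept edges stays in one cluster, hence in one ball, so by [ball_bridge] the kept
    edges of [F] are bridges among all kept edges. Counting components bounds them by the other
    edges of [T]. *)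
Lemma card_good_le s r W F : 0 <= r -> 0 <= W -> 3 * r <= delta * W ->
  F \subset D -> [disjoint T & F] -> (forall e, e \in F -> W <= edge_weight e) ->
  (#|[set e in F | good s r e]%SET| <= #|[set e in T | ~~ good s r e]%SET|)%N.
Proof.
move=> r0 W0 rW sF dis Fw.
pose T' := [set e in T | good s r e]%SET.
have -> : [set e in T | ~~ good s r e]%SET = T :\: T'.
  by apply/setP => e; rewrite !finset.inE; case: (e \in T); rewrite ?andbF ?andbT.
have sT' : T' \subset T by apply/fintype.subsetP => e; rewrite finset.inE => /andP[].
apply: card_bridges_le => //.
- by move=> e /(fintype.subsetP TG)/graph_edgesP[a [b [-> _]]]; exists a, b.
- apply: fintype.disjointWl sT' _; apply: fintype.disjointWr dis.
  by apply/fintype.subsetP => e; rewrite finset.inE => /andP[].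
set A := _ :|: T'.
have goodA e : e \in A -> (e \in H) && good s r e.
  rewrite !finset.inE => /orP[/andP[/(fintype.subsetP sF) -> ->]|/andP[-> ->]] //.
  by rewrite orbT.
move=> e eF; have eA : e \in A by rewrite finset.in_setU eF.
move: eF; rewrite finset.inE => /andP[eF ge].
have /andP[eH _] := goodA _ eA.
have [a [b [Ee eab]]] := graph_edgesP (fintype.subsetP HG _ eH).
exists a, b; split => //; apply/negP => /connectP[p pp lp].
have wab := Fw _ eF; rewrite Ee edge_weightE // in wab.
have [c cen] := good_center ge.
have ca : is_center s r c a by apply: cen; rewrite Ee !finset.inE eqxx.
have sA : A \subset H by apply/fintype.subsetP => f /goodA/andP[].
(* Kept edges join vertices with the same center, so the center is constant along the path. *)
have cp : forall z, z \in a :: p -> is_center s r c z.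
  have := sub_path (sub_adj (finset.subsetDl A [set e]%SET)) pp.
  elim: (p) (a) (ca) => [|y q IH] u cu /=; first by move=> _ z; rewrite finset.inE => /eqP ->.
  move=> /andP[uy pq] z; rewrite finset.inE => /orP[/eqP -> //|].
  apply: IH => //; have /andP[_ /good_center[c' cen']] := goodA _ uy.
  rewrite (@is_center_uniq s r c c' u) //; apply: cen'; rewrite !finset.inE eqxx ?orbT //.
apply: (@ball_bridge R G delta H delta_ge0 HG girth A a b c r W p) => //.
- by rewrite /adj -Ee.
- by rewrite -Ee.
- by move=> z /cp[].
Qed.

(** The average of [card_good_le] over all orders: the ratio is the probability that the edge is
    kept. *)
Lemma sum_cover_ratio_le r W F : 0 <= r -> 0 <= W -> 3 * r <= delta * W ->
  F \subset D -> [disjoint T & F] -> (forall e, e \in F -> W <= edge_weight e) ->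
  \sum_(e in F) (#|covers r e|%:R / #|hits r e|%:R) <=
  \sum_(e in T) (1 - #|covers r e|%:R / #|hits r e|%:R) :> R.
Proof.
move=> r0 W0 rW sF dis Fw.
pose N : R := #|{perm G}|%:R.
have N0 : 0 < N by rewrite ltr0n; apply/card_gt0P; exists 1%g.
have ratio e : e \in H ->
    #|covers r e|%:R / #|hits r e|%:R = N^-1 * \sum_(s : {perm G}) (good s r e)%:R :> R.
  move=> eH; have := card_first_hit (covers_sub_hits r eH).
  move=> /(congr1 (fun n => n%:R : R)); rewrite !natrM => E.
  have h0 : #|hits r e|%:R != 0 :> R by rewrite pnatr_eq0 -lt0n card_hits_gt0.
  rewrite -natr_sum (_ : (\sum_s good s r e)%N = #|[set s | good s r e]%SET|); last first.
    by rewrite cardsE -sum1_card [RHS]big_mkcond.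
  apply: (mulIf h0); apply: (mulfI (lt0r_neq0 N0)).
  rewrite divfK // [RHS]mulrA mulVKf ?lt0r_neq0 //.
  by rewrite [in RHS]E mulrC.
have sFH e : e \in F -> e \in H by move=> /(fintype.subsetP sF) eD; rewrite finset.in_setU eD orbT.
have sTH e : e \in T -> e \in H by move=> eT; rewrite finset.in_setU eT.
rewrite (eq_bigr _ (fun e eF => ratio e (sFH e eF))).
rewrite [leRHS](eq_bigr (fun e => N^-1 * \sum_(s : {perm G}) (~~ good s r e)%:R)); last first.
  move=> e eT; rewrite ratio ?sTH //.
  rewrite -[X in X - _](mulVf (lt0r_neq0 N0)) -mulrBr; congr (_ * _).
  rewrite /N -sum1_card natr_sum -sumrB; apply: eq_bigr => s _.
  by case: good; rewrite ?subrr ?subr0.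
rewrite -!mulr_sumr ler_wpM2l ?invr_ge0 ?(ltW N0) //.
rewrite exchange_big [leRHS]exchange_big /=; apply: ler_sum => s _.
rewrite -!natr_sum ler_nat.
have := @card_good_le s r W F r0 W0 rW sF dis Fw.
have cardE' (X : {set {set G}}) (P : pred {set G}) :
    (\sum_(e in X) P e)%N = #|[set e in X | P e]%SET|.
  rewrite -sum1_card [RHS](eq_bigl (fun e => (e \in X) && P e)); last first.
    by move=> e; rewrite finset.inE.
  by rewrite [RHS]big_mkcondr; apply: eq_bigr => e _; case: (P e).
by rewrite !cardE'.
Qed.

Definition log_hits e r : R := ln #|hits r e|%:R.

Lemma log_hits_ge0 e r : e \in H -> 0 <= r -> 0 <= log_hits e r.
Proof. by move=> eH r0; rewrite ln_ge0 // ler1n card_hits_gt0. Qed.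

Lemma log_hits_le e r t : e \in H -> 0 <= r -> r <= t -> log_hits e r <= log_hits e t.
Proof.
move=> eH r0 rt; rewrite ler_ln ?posrE ?ltr0n ?card_hits_gt0 ?(le_trans r0) //.
by rewrite ler_nat subset_leq_card // hits_le.
Qed.

Lemma log_hits_card e r : e \in H -> 0 <= r -> log_hits e r <= ln #|G|%:R.
Proof.
move=> eH r0; have h := card_hits_gt0 eH r0.
rewrite ler_ln ?posrE ?ltr0n //; last exact: leq_trans h (max_card _).
by rewrite ler_nat max_card.
Qed.

(** A center reaching one end at radius [r] covers the edge at radius [r + t]; the exponential is
    the ratio of the two numbers of hits. *)
Lemma cover_ratio_ge e r t : e \in H -> 0 <= r -> edge_weight e <= t ->
  expR (- (log_hits e (r + t) - log_hits e r)) <=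
  #|covers (r + t) e|%:R / #|hits (r + t) e|%:R.
Proof.
move=> eH r0 wt; have t0 := le_trans (edge_weight_ge0 e) wt.
have h1 : (0 < #|hits r e|)%N by apply: card_hits_gt0.
have h2 : (0 < #|hits (r + t) e|)%N by apply: card_hits_gt0 => //; lra.
rewrite /log_hits opprB expRD expRN !lnK ?posrE ?ltr0n //.
rewrite ler_wpM2r ?invr_ge0 // ler_nat.
exact/subset_leq_card/hits_sub_covers.
Qed.

End Lightness.

(** * Lightness *)

Section Scales.
Variables (R : realType) (G : wgraph R) (delta : R) (T D : {set {set G}}).
Let H := T :|: D.
Hypotheses (TG : T \subset @graph_edges R G)
  (DG : D \subset @graph_edges R G) (cT : connected_by T).
Hypothesis girth : forall a b q, ~ short_cycle delta H a b q.
Hypotheses (delta_ge48 : 48 <= delta) (card_le : ln #|G|%:R <= delta).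
Implicit Types (e f : {set G}) (F : {set {set G}}) (r t W : R).

Let delta_ge0 : 0 <= delta. Proof. exact: le_trans delta_ge48. Qed.

Let delta_gt0 : 0 < delta. Proof. exact: lt_le_trans delta_ge48. Qed.

Let sTH e : e \in T -> e \in H.
Proof. by move=> eT; rewrite finset.in_setU eT. Qed.

Let log_hits := log_hits T D.

(** Bounds the probability that [f] is cut at scale [W], averaged over the radius; heavy edges get
    the trivial bound 1. *)
Definition scale_charge W f : R :=
  if 24 * edge_weight f <= delta * W then
    12 * edge_weight f / (delta * W) *
      (log_hits f (delta * W / 3) - log_hits f (delta * W / 12))
  else 1.

(** The radius runs over [k * tau] with [2 * K <= k < 4 * K], a grid between [delta * W / 6] and
    [delta * W / 3]; [sum_cover_ratio_le] is averaged over [k]. *)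
Lemma scale_bound w0 W F : 0 < w0 -> 0 < W ->
  (forall e, edge_weight e = 0 \/ w0 <= edge_weight e) ->
  F \subset D -> [disjoint T & F] ->
  (forall e, e \in F -> W <= edge_weight e <= 2 * W) ->
  expR (- 24) * #|F|%:R <= \sum_(f in T) scale_charge W f.
Proof.
move=> w00 W0 wmin sF dis Fw.
have dW0 : 0 < delta * W by rewrite mulr_gt0.
(* [K] is so large that the grid width [tau] is at most [w0]; every positive weight can then be
   rounded to the grid. *)
have [K KN KW] : exists2 K : nat, (0 < K)%N & delta * W / 12 / w0 <= K%:R.
  exists (Num.truncn (delta * W / 12 / w0)).+1 => //.
  have h : 0 <= delta * W / 12 / w0 by rewrite !divr_ge0 // ltW.
  by have /andP[_ /ltW] := truncn_itv h.
have K0 : 0 < K%:R :> R by rewrite ltr0n.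
pose tau := delta * W / 12 / K%:R.
have tau0 : 0 < tau by rewrite divr_gt0 // divr_gt0.
have tauw : tau <= w0 by rewrite ler_pdivrMr // [leRHS]mulrC -ler_pdivrMr.
have Ktau : K%:R * tau = delta * W / 12 by rewrite mulrC divfK // gt_eqF.
have K4tau : (4 * K)%:R * tau = delta * W / 3 by rewrite natrM -mulrA Ktau; field.
have twK : (4 * K - 2 * K)%N = (2 * K)%N by rewrite -mulnBl.
have leK m k : (m <= K -> 2 * K <= k < 4 * K -> m <= k)%N.
  by move=> mK /andP[Kk _]; apply: leq_trans mK (leq_trans _ Kk); rewrite leq_pmull.
have step e : exists m : nat, edge_weight e <= m%:R * tau /\ m%:R * tau <= 2 * edge_weight e.
  apply: natmul_approx => //; case: (wmin e) => h; first by left.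
  by right; exact: le_trans h.
pose g e k := log_hits e (k%:R * tau).
have ktau0 k : 0 <= k%:R * tau by rewrite mulr_ge0 // ltW.
have gmono e : e \in H -> {homo g e : i j / (i <= j)%N >-> i <= j}.
  by move=> eH i j ij; apply: log_hits_le => //; rewrite ler_wpM2r ?ler_nat // ltW.
pose ratio e k : R := #|covers T D (k%:R * tau) e|%:R / #|hits T D (k%:R * tau) e|%:R.
have ratio_ge e m k : e \in H -> edge_weight e <= m%:R * tau -> (m <= k)%N ->
    expR (- (g e k - g e (k - m)%N)) <= ratio e k.
  move=> eH wm mk.
  have := @cover_ratio_ge R G T D TG DG e ((k - m)%:R * tau) (m%:R * tau) eH (ktau0 _) wm.
  by rewrite -mulrDl -natrD subnK.
have small m w : m%:R * tau <= 2 * w -> 24 * w <= delta * W -> (m <= K)%N.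
  move=> h1 h2; rewrite -(ler_nat R) -(ler_pM2r tau0) Ktau; lra.
have Fpart e : e \in F -> (2 * K)%:R * expR (- 24) <= \sum_(2 * K <= k < 4 * K) ratio e k.
  move=> eF; have /andP[w1 w2] := Fw _ eF.
  have eH : e \in H by rewrite finset.in_setU (fintype.subsetP sF _ eF) orbT.
  have [m [m1 m2]] := step e.
  (* Here [delta >= 48] enters: weights up to [2 * W] are rounded to at most [K] grid steps. *)
  have d48 : 48 * W <= delta * W by rewrite ler_wpM2r // ltW.
  have mK : (m <= K)%N by apply: (small _ _ m2); lra.
  (* Since [m * tau <= 4 * W] and the logarithm grows by at most [delta], the exponents average at
     most [4 * W * delta / (2 * K * tau) = 24]. *)
  rewrite -{1}twK; apply: le_trans (@sum_expR_ge R (fun k => g e k - g e (k - m)%N) _ _ 24 _) _.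
    rewrite twK; apply: le_trans (sum_shift_le (gmono e eH) mK) _.
    apply: le_trans (_ : m%:R * delta <= _).
      rewrite ler_wpM2l //; apply: le_trans card_le.
      have := @log_hits_card R G T D TG DG e _ eH (ktau0 (4 * K)%N).
      have := @log_hits_ge0 R G T D TG DG e _ eH (ktau0 K).
      by rewrite /g /log_hits; lra.
    rewrite -(ler_pM2r tau0) natrM.
    have : m%:R * tau * delta <= 4 * W * delta by rewrite ler_wpM2r //; lra.
    move: Ktau; set x := K%:R * tau => Ktau.
    have -> : 24 * (2 * K%:R) * tau = 48 * x by rewrite /x; ring.
    have -> : m%:R * delta * tau = m%:R * tau * delta by ring.
    by rewrite Ktau; lra.
  by apply: ler_sum_nat => k hk; apply: ratio_ge => //; exact: leK.
have Tpart f : f \in T ->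
    \sum_(2 * K <= k < 4 * K) (1 - ratio f k) <= (2 * K)%:R * scale_charge W f.
  move=> fT; have fH := sTH fT; rewrite /scale_charge; case: ifP => hw; last first.
    rewrite mulr1 -[X in _ <= X](_ : \sum_(2 * K <= k < 4 * K) 1 = _); last first.
      by rewrite sumr_const_nat twK.
    apply: ler_sum => k _; rewrite gerBl divr_ge0 //.
  have [m [m1 m2]] := step f.
  have mK : (m <= K)%N by apply: (small _ _ m2).
  (* By [1 - expR (- x) <= x], the cut probability is at most the increment of the logarithm. *)
  apply: le_trans (_ : \sum_(2 * K <= k < 4 * K) (g f k - g f (k - m)%N) <= _).
    apply: ler_sum_nat => k hk.
    have h1 : expR (- (g f k - g f (k - m)%N)) <= ratio f k.
      by apply: ratio_ge => //; exact: leK.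
    by have := expR_ge1Dx (- (g f k - g f (k - m)%N)); lra.
  apply: le_trans (sum_shift_le (gmono f fH) mK) _.
  rewrite /g K4tau Ktau mulrA ler_wpM2r //.
    rewrite subr_ge0; apply: log_hits_le => //; lra.
  have Kne : K%:R != 0 :> R by rewrite gt_eqF.
  have dWne : delta * W != 0 by rewrite gt_eqF.
  rewrite -(ler_pM2r tau0) natrM.
  have -> : 2 * K%:R * (12 * edge_weight f / (delta * W)) * tau = 2 * edge_weight f.
    rewrite (_ : _ * tau = 24 * edge_weight f / (delta * W) * (K%:R * tau)); last by ring.
    by rewrite Ktau; field; rewrite !gt_eqF.
  exact: m2.
have KK0 : 0 < (2 * K)%:R :> R by rewrite ltr0n muln_gt0.
rewrite -(ler_pM2l KK0) mulr_sumr.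
apply: le_trans (_ : \sum_(f in T) \sum_(2 * K <= k < 4 * K) (1 - ratio f k) <= _); last first.
  exact: ler_sum.
apply: le_trans (_ : \sum_(e in F) \sum_(2 * K <= k < 4 * K) ratio e k <= _).
  rewrite mulrA mulr_natr -sumr_const; exact: ler_sum.
rewrite exchange_big [leRHS]exchange_big /=; apply: ler_sum_nat => k /andP[_ hk].
apply: (@sum_cover_ratio_le R G delta T D delta_ge0 TG DG cT girth _ W) => //.
- exact: ltW.
- have : k%:R * tau <= (4 * K)%:R * tau by rewrite ler_wpM2r ?ler_nat ?(ltW tau0) // ltnW.
  by rewrite K4tau; lra.
- by move=> e /Fw/andP[].
Qed.

(** Where [f] is light, the logarithms telescope to at most [12 * w / delta * (2 * delta) = 24 * w].
    The scales [W < 24 * w / delta] form a geometric sum of at most [48 * w / delta <= w]. *)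
Lemma total_scale_charge w0 (I : nat) f : 0 < w0 -> f \in T ->
  \sum_(i < I) w0 * 2 ^+ i * scale_charge (w0 * 2 ^+ i) f <= 25 * edge_weight f.
Proof.
move=> w00 fT; have fH := sTH fT; set w := edge_weight f.
have w_ge0 : 0 <= w := edge_weight_ge0 f.
have d0 := delta_gt0.
have W0 (i : nat) : 0 < w0 * 2 ^+ i by rewrite mulr_gt0 // exprn_gt0.
pose a i := log_hits f (delta * (w0 * 2 ^+ i) / 12).
have r0 (i : nat) : 0 <= delta * (w0 * 2 ^+ i) / 12.
  by rewrite divr_ge0 // mulr_ge0 // ltW.
have a_ge0 i : 0 <= a i by apply: log_hits_ge0.
have a_le i : a i <= delta by apply: le_trans card_le; apply: log_hits_card.
have a_mono i : a i <= a i.+2.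
  apply: log_hits_le => //; rewrite ler_wpM2r // ler_wpM2l // ler_wpM2l ?(ltW w00) //.
  by apply: ler_weXn2l; rewrite ?ler1n // (leqW (leqnSn i)).
have Ea i : log_hits f (delta * (w0 * 2 ^+ i) / 3) = a i.+2.
  by rewrite /a !exprS; congr (log_hits f _); field.
apply: le_trans (_ : \sum_(i < I) (12 * w / delta * (a i.+2 - a i) +
    (if w0 * 2 ^+ i < 24 * w / delta then w0 * 2 ^+ i else 0)) <= _).
  apply: ler_sum => i _; rewrite /scale_charge -/w Ea -/(a i).
  have h : 0 <= 12 * w / delta * (a i.+2 - a i).
    by rewrite mulr_ge0 // ?subr_ge0 // divr_ge0 // mulr_ge0.
  case: ifP => hw.
    have -> : w0 * 2 ^+ i * (12 * w / (delta * (w0 * 2 ^+ i)) * (a i.+2 - a i)) =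
        12 * w / delta * (a i.+2 - a i).
      have ne : w0 * 2 ^+ i != 0 by rewrite gt_eqF.
      have dne : delta != 0 by rewrite gt_eqF.
      move: ne; set W := w0 * 2 ^+ i => ne; field; by rewrite dne ne.
    by rewrite lerDl; case: ifP => // _; exact: ltW.
  rewrite mulr1 ifT; first by rewrite lerDr.
  by rewrite ltr_pdivlMr // mulrC ltNge hw.
rewrite big_split /= -mulr_sumr -big_mkcond /=.
have h1 := @sum_two_step R a I delta a_ge0 a_le.
have h2 : \sum_(i < I | w0 * 2 ^+ i < 24 * w / delta) w0 * 2 ^+ i <= 2 * (24 * w / delta).
  by apply: sum_geometric_lt; rewrite ?(ltW w00) // divr_ge0 // mulr_ge0.
have h3 : 24 * w / delta <= w / 2.
  have : w * 48 <= w * delta by rewrite ler_wpM2l.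
  by rewrite ler_pdivrMr //; lra.
have h4 : 12 * w / delta * \sum_(i < I) (a i.+2 - a i) <= 12 * w / delta * (2 * delta).
  by rewrite ler_wpM2l // divr_ge0 // mulr_ge0.
have h5 : 12 * w / delta * (2 * delta) = 24 * w by field; rewrite gt_eqF.
lra.
Qed.

(** The dyadic scales from [w0] on cover all positive weights. An edge at scale [W] weighs at most
    [2 * W], which with the 25 of [total_scale_charge] gives 50. *)
Lemma lightness : total_weight (D :\: T) <= 50 * expR 24 * total_weight T.
Proof.
have [w0 w00 wmin] := min_positive (@edge_weight_ge0 R G).
have [I HI] : exists I : nat, forall e, edge_weight e < w0 * 2 ^+ I.
  pose B := \sum_(e : {set G}) edge_weight e.
  have [I hI] := dyadic_bound B w00; exists I => e; apply: le_lt_trans hI.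
  rewrite /B (bigD1 e) //= lerDl sumr_ge0 // => f _; exact: edge_weight_ge0.
pose W (i : nat) := w0 * 2 ^+ i.
have W0 i : 0 < W i by rewrite mulr_gt0 // exprn_gt0.
pose F (i : nat) := [set e in D :\: T | W i <= edge_weight e <= 2 * W i]%SET.
have FW (i : nat) : expR (- 24) * #|F i|%:R <= \sum_(f in T) scale_charge (W i) f.
  apply: (@scale_bound w0) => //.
  - by apply/fintype.subsetP => e; rewrite !finset.inE => /andP[/andP[]].
  - rewrite finset.disjoints_subset; apply/fintype.subsetP => e eT; rewrite !finset.inE eT.
    by [].
  - by move=> e; rewrite finset.inE => /andP[].
have h1 : total_weight (D :\: T) <= \sum_(i < I) 2 * W i * #|F i|%:R.
  apply: le_trans (_ : \sum_(e in D :\: T) \sum_(i < I) (if e \in F i then 2 * W i else 0) <= _).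
    apply: ler_sum => e eD; case: (wmin e) => [->|we].
      by apply: sumr_ge0 => i _; case: ifP => // _; rewrite mulr_ge0 // ltW.
    have [i /andP[i1 i2]] := dyadic_scale we (HI e).
    have i3 : edge_weight e <= 2 * W i by move: i2; rewrite exprS /W; lra.
    rewrite (bigD1 i) //= finset.inE eD i1 i3 /=.
    apply: le_trans i3 _; rewrite lerDl sumr_ge0 // => j _.
    by case: ifP => // _; rewrite mulr_ge0 // ltW.
  rewrite exchange_big /=; apply: ler_sum => i _.
  rewrite -big_mkcondr /= sumr_const mulr_natr.
  rewrite le_eqVlt; apply/orP; left; apply/eqP; congr (_ *+ _); apply: eq_card => e.
  change ((e \in D :\: T) && (e \in F i) = (e \in F i)).
  by rewrite [e \in F i]finset.inE; case: (e \in D :\: T).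
apply: le_trans h1 _.
have h2 : \sum_(i < I) 2 * W i * #|F i|%:R <=
    2 * expR 24 * \sum_(i < I) \sum_(f in T) W i * scale_charge (W i) f.
  rewrite mulr_sumr; apply: ler_sum => i _; rewrite -mulr_sumr.
  have -> : #|F i|%:R = expR 24 * (expR (- 24) * #|F i|%:R) :> R.
    by rewrite mulrA -expRD subrr expR0 mul1r.
  rewrite [leLHS](_ : _ = 2 * expR 24 * (W i * (expR (- 24) * #|F i|%:R))); last by ring.
  by rewrite ler_wpM2l ?mulr_ge0 ?expR_ge0 // ler_wpM2l ?(ltW (W0 i)).
apply: le_trans h2 _; rewrite exchange_big /=.
have h3 : \sum_(f in T) \sum_(i < I) W i * scale_charge (W i) f <= 25 * total_weight T.
  by rewrite /total_weight mulr_sumr; apply: ler_sum => f fT; exact: total_scale_charge.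
rewrite [leRHS](_ : _ = 2 * expR 24 * (25 * total_weight T)); last by ring.
by rewrite ler_wpM2l ?mulr_ge0 ?expR_ge0.
Qed.

End Scales.

(** * Graphs with few vertices *)

Section SmallScales.
Variables (R : realType) (G : wgraph R) (delta : R) (T D : {set {set G}}).
Hypotheses (TG : T \subset @graph_edges R G)
  (DG : D \subset @graph_edges R G) (cT : connected_by T) (delta_ge0 : 0 <= delta).
Hypothesis girth : forall a b q, ~ short_cycle delta (T :|: D) a b q.

Lemma walk_length_uniq_le (A : {set {set G}}) (x : G) p : A \subset @graph_edges R G ->
  path (adj A) x p -> uniq (x :: p) -> walk_length x p <= total_weight A.
Proof.
move=> + pp; elim: p A x pp => [|y p IH] A x /=.
  by move=> _ _ _; apply: sumr_ge0 => e _; exact: edge_weight_ge0.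
move=> /andP[xy pp] sA /andP[xyp up].
rewrite (total_weight_setD1 xy) edge_weightE ?(sub_adj_edge sA) // lerD2l.
apply: IH up; last exact: fintype.subset_trans (finset.subsetDl _ _) sA.
exact: path_adj_avoid.
Qed.

(** An edge of [D :\: T] heavier than all of [T] would close a short cycle with a path in [T]. *)
Lemma lightness_small : total_weight (D :\: T) <= #|D|%:R * total_weight T.
Proof.
have tT0 : 0 <= total_weight T by apply: sumr_ge0 => e _; exact: edge_weight_ge0.
apply: le_trans (_ : \sum_(e in D :\: T) total_weight T <= _); last first.
  rewrite sumr_const -[leLHS]mulr_natl ler_wpM2r // ler_nat.
  exact/subset_leq_card/finset.subsetDl.
apply: ler_sum => e; rewrite finset.inE => /andP[eT eD].
have [a [b [Ee eab]]] := graph_edgesP (fintype.subsetP DG _ eD).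
rewrite Ee edge_weightE // leNgt; apply/negP => lt.
have /connectP[p0 pp0 lp0] := forallP (forallP cT a) b.
have [p [pp lp up _]] := walk_shorten (sub_adj_edge TG) pp0.
have wp := walk_length_uniq_le TG pp up.
apply: (@girth a b p); split => //.
- by rewrite /adj -Ee finset.in_setU eD orbT.
- apply: sub_path pp => u v uv; rewrite /adj in_setD1 finset.in_setU [_ \in T]uv andbT.
  by apply: contraNneq eT => E; rewrite Ee -E.
- by rewrite lp.
- have w0 := weight_ge0 eab.
  have : 0 <= delta * weight a b by rewrite mulr_ge0.
  lra.
Qed.

End SmallScales.

(** * Runs of the algorithm *)

Section Runs.
Variables (R : realType) (G : wgraph R).
Implicit Types (S : {set G}) (h p q r s : seq G) (u v x y z : G) (bs : seq (G * G)).

Lemma internal_path_rev S x y p :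
  internal_path S x y p -> internal_path S y x (rev (belast x p)).
Proof.
case=> pp lp up ip; split.
- by rewrite -lp path_edge_rev.
- by rewrite -lp last_rev_last.
- by rewrite -lp -rev_rcons -lastI rev_uniq.
- case: p {pp lp up} ip => [|z p] //=.
  by rewrite rev_cons belast_rcons /= all_rev.
Qed.

Lemma internal_path_mem S x y p z :
  internal_path S x y p -> x \in S -> y \in S -> z \in x :: p -> z \in S.
Proof.
case=> _ lp _ /allP ip xS yS; rewrite lastI mem_rcons lp inE => /orP[/eqP -> //|].
by case: p {lp} ip => [|w p] //= ip; rewrite inE => /orP[/eqP -> //|/ip].
Qed.

Lemma internal_path_cons S x y z p : edge x y -> y \in S -> x \notin y :: p ->
  internal_path S y z p -> internal_path S x z (y :: p).
Proof.
move=> exy yS xp [pp lp up ip]; split => //=; first by rewrite exy.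
  by rewrite xp.
by case: p ip {pp lp up xp} => [|w p] //= ->; rewrite yS.
Qed.

Lemma internal_path_sub S S' x y p : S \subset S' ->
  internal_path S x y p -> internal_path S' x y p.
Proof.
move=> /fintype.subsetP sS [pp lp up ip]; split => //.
by apply: sub_all ip => z; exact: sS.
Qed.

Lemma dist_le_path S x y p : internal_path S x y p ->
  (dist S x y <= (walk_length x p)%:E)%E.
Proof. by move=> ip; apply: ereal_inf_lbound; exists p. Qed.

Lemma dist_sub S S' x y : S \subset S' -> (dist S' x y <= dist S x y)%E.
Proof.
move=> sS; apply: le_ereal_inf_tmp => _ [p [ip ->]].
exact/dist_le_path/(internal_path_sub sS).
Qed.

Lemma dist_sym_le S x y : (dist S x y <= dist S y x)%E.
Proof.
apply: le_ereal_inf_tmp => _ [p [ip ->]].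
have [pp lp _ _] := ip.
by rewrite -(walk_length_rev pp) lp; apply/dist_le_path/internal_path_rev.
Qed.

Lemma explored_drop h k : explored (drop k h) \subset explored h.
Proof. by apply/fintype.subsetP => z; rewrite !in_explored; exact: mem_drop. Qed.

Lemma explored_cat l h : explored h \subset explored (l ++ h).
Proof. by apply/fintype.subsetP => z; rewrite !in_explored mem_cat orbC => ->. Qed.

(** Unless [y = v], the edge was once blocked by an edge ending at [v], so [y] and [v] were then
    within [(1 + delta) * weight y x]; exploring more vertices never increases distances. *)
Lemma eligible_path_le delta h v y x p : 0 <= delta ->
  eligible delta h v y x -> shortest_path (explored h) v y p ->
  walk_length v p <= (1 + delta) * weight y x.
Proof.
move=> d0 [[eyx yh xh] _ alt] [ip dp]; rewrite -lee_fin dp.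
case: alt => [Ey|[k [u' [_ _ _ dk]]]].
  have i0 : internal_path (explored h) v y [::] by split.
  apply: le_trans (dist_le_path i0) _; rewrite lee_fin mulr_ge0 ?weight_ge0 //; lra.
apply: le_trans (dist_sub _ _ (explored_drop h k)) _.
exact: le_trans (dist_sym_le _ _ _) dk.
Qed.

(** The way out can be walked back: cross the edge, then reverse the path to [y], all of it explored
    by now. *)
Lemma return_path_le h h1 v y x p r : v \in h -> {subset h <= h1} ->
  boundary (explored h) y x -> shortest_path (explored h) v y p ->
  shortest_path (explored h1) x v r ->
  walk_length x r <= weight y x + walk_length v p.
Proof.
move=> vh hh1 [eyx yh xh] [ip _] [_ dr]; rewrite -lee_fin dr.
have [pp lp _ _] := ip.
have sh : explored h \subset explored h1.
  by apply/fintype.subsetP => z; rewrite !in_explored; exact: hh1.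
have -> : weight y x + walk_length v p = walk_length x (y :: rev (belast v p)).
  by rewrite /= (weight_sym eyx) -(walk_length_rev pp) lp.
apply/dist_le_path/internal_path_cons.
- by rewrite edge_sym.
- exact: (fintype.subsetP sh).
- have -> : y :: rev (belast v p) = rev (v :: p) by rewrite [v :: p]lastI rev_rcons lp.
  rewrite mem_rev; apply: contra xh => xp.
  by apply: internal_path_mem ip _ _ xp; rewrite ?in_explored // -in_explored.
- exact/(internal_path_sub sh)/internal_path_rev.
Qed.

(** Apart from the recursive parts, one iteration costs at most [(1 + delta) + 1 + (2 + delta)]
    times the weight of its edge: way out, edge, way back. *)
Lemma blocking_charge delta v h p h' : 0 <= delta ->
  blocking delta v h p h' -> v \in h ->
  exists bs, [/\ h' = visited h bs, greedy delta h bs,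
    path (@edge R G) v p /\ last v p = v, {subset [seq b.2 | b <- bs] <= p}
    & walk_length v p <= 2 * (2 + delta) * \sum_(b <- bs) weight b.1 b.2].
Proof.
move=> d0; elim=> {v h p h'} [v h _ _|v h y x p q h1 r s h2 el sp _ IH1 sr _ IH2 vh].
  by exists [::]; split => //; rewrite big_nil mulr0.
have [bs1 [E1 g1 [pq lq] s1 w1]] := IH1 (mem_head _ _).
have hh1 : {subset x :: h <= h1}.
  by move=> z zh; rewrite E1 mem_cat zh orbT.
have hh1' : {subset h <= h1} by move=> z zh; apply: hh1; rewrite inE zh orbT.
have [bs2 [E2 g2 [ps ls] s2 w2]] := IH2 (hh1' _ vh).
have wp := eligible_path_le d0 el sp.
have [by_ nbl _] := el.
have wr := return_path_le vh hh1' by_ sp sr.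
have [[pp lp _ _] _] := sp; have [[pr lr _ _] _] := sr; have [eyx yh xh] := by_.
exists (bs2 ++ bs1 ++ [:: (y, x)]); split.
- by rewrite E2 E1 !visited_cat.
- by rewrite !greedy_cat !visited_cat /= -[visited _ bs1]E1.
- by rewrite cat_path /= !cat_path !last_cat /= !last_cat lp lq lr pp eyx pq pr ps ls.
- move=> z; rewrite !map_cat !(mem_cat, inE) => /or3P[/s2 ->|/s1 ->|/eqP ->];
  by rewrite ?eqxx ?orbT.
- rewrite !big_cat /= big_seq1 /= walk_length_cat /= !walk_length_cat lp lq lr !mulrDr.
  lra.
Qed.

(** The history at the end of the call at [z] survives as a suffix of [h], so [k] records when that
    call ended. *)
Definition finished delta h z : Prop :=
  exists2 k, z \in drop k h & forall y x, ~ eligible delta (drop k h) z y x.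

Lemma finished_cat delta l h z : finished delta h z -> finished delta (l ++ h) z.
Proof.
by case=> k zk nel; exists (k + size l)%N; rewrite -drop_drop drop_size_cat.
Qed.

Lemma blocking_finished delta v h p h' : blocking delta v h p h' -> v \in h ->
  exists l, [/\ h' = l ++ h, finished delta h' v & forall z, z \in l -> finished delta h' z].
Proof.
elim=> {v h p h'} [v h nel vh|v h y x p q h1 r s h2 _ _ _ IH1 _ _ IH2 vh].
  by exists [::]; split => //; exists 0%N; rewrite drop0.
have [l1 [E1 f1 fl1]] := IH1 (mem_head _ _).
have [] := IH2; first by rewrite E1 mem_cat inE vh !orbT.
move=> l2 [E2 f2 fl2]; exists (l2 ++ l1 ++ [:: x]); split => //.
  by rewrite E2 E1 -!catA.
move=> z; rewrite !mem_cat inE => /or3P[/fl2 //|/fl1|/eqP ->]; rewrite E2;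
  exact: finished_cat.
Qed.

Lemma greedy_uniq delta v bs : greedy delta [:: v] bs -> uniq (visited [:: v] bs).
Proof.
elim: bs => [|[y x] bs IH] //= [[_ _ xv] _ /IH ->].
by move: xv; rewrite in_explored => ->.
Qed.

(* Let [(y, x)] be a lightest boundary edge left over. It was blocked when the
   call at [y] ended. At the last time it was blocked, the blocking edge had
   the next explored vertex [z] as end point, and then it would have been
   eligible when the call at [z] ended. *)
Lemma all_finished_explored delta h v : connected_graph G -> v \in h -> uniq h ->
  (forall z, z \in h -> finished delta h z) -> forall z, z \in h.
Proof.
move=> cG vh uh fin z; apply: contraPT isT => zh _.
pose P (b : G * G) := `[< boundary (explored h) b.1 b.2 >].
have [b0 Pb0] : exists b0, P b0.
  have /connectP[p pp lp] := cG v z.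
  have := first_exit (P := fun z => z \in h) pp vh.
  rewrite -lp => /(_ (negP zh)) [p1 [d [p2 [_ p1h dh ed]]]].
  exists (last v p1, d); apply/asboolP; split => //=; rewrite in_explored.
    by apply: p1h; exact: mem_last.
  exact/negP.
case: (@arg_minP _ _ _ b0 P (fun b => weight b.1 b.2) Pb0) => -[y x] /asboolP/= bd minb.
have [eyx yh xh] := bd; rewrite in_explored in yh.
have bdk k : y \in drop k h -> boundary (explored (drop k h)) y x.
  move=> yk; split => //; rewrite ?in_explored //.
  by apply: contra xh; rewrite in_explored; exact: mem_drop.
have nbl0 : ~ blocked delta (explored h) y x.
  move=> [u' [x' [_ bd' lt _]]]; have := minb (u', x'); rewrite leNgt lt => h1.
  by suff : false by []; apply: h1; apply/asboolP.
pose Q k := `[< blocked delta (explored (drop k h)) y x >].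
have exQ : exists k, Q k.
  (* In the call at [y] the edge qualifies by its end point, so it must have been blocked when that
     call ended. *)
  have [k yk nel] := fin y yh; exists k; apply: contraPT isT => /asboolPn nb _.
  by case: (nel y x); split => //; [exact: bdk|left].
(* The least index marks the last time at which the edge was blocked; index 0 is the present,
   excluded by [nbl0]. *)
case: (ex_minnP exQ) => -[|k] /asboolP; first by rewrite drop0.
move=> bl mink; have [u' [z' bb]] := bl; have [[_ yk _] [eu' u'k z'k] lt dz] := bb.
rewrite in_explored in yk; rewrite in_explored in u'k.
have kh : (k < size h)%N.
  rewrite ltnNge; apply/negP => hk; move: yk.
  by rewrite drop_oversize // (leq_trans hk).
have Edrop := drop_nth v kh; set w := nth v h k in Edrop.
have nblk : ~ blocked delta (explored (drop k h)) y x.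
  by move=> b; have := mink k; rewrite ltnn => h1; suff : false by []; apply/h1/asboolP.
(* [w] is the vertex explored next. If it were not [z'], the same edge would still block [(y, x)],
   as distances do not grow. *)
have wz : w = z'.
  apply: contra_notP nblk => /eqP wz; exists u', z'; split => //.
  - by apply: bdk; rewrite Edrop inE yk orbT.
  - split => //; rewrite in_explored Edrop in_cons; first by rewrite [X in _ || X]u'k orbT.
    by rewrite negb_or eq_sym wz -in_explored.
  - by apply: le_trans dz; apply: dist_sub; rewrite Edrop -cat1s; exact: explored_cat.
have wh : w \in h by rewrite mem_nth.
have [j wj nel] := fin w wh.
(* Since [h] has no repetitions, a suffix containing [w] is at least as long as [drop k h]: the call
   at [w] ended after the last blocking. *)
have jk : (j <= k)%N.
  rewrite leqNgt; apply/negP => kj; move: uh; rewrite -(cat_take_drop j h) cat_uniq.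
  case/and3P => _ /hasPn/(_ w wj) /negP nt _; apply: nt.
  by rewrite /= /w -(nth_take v kj) mem_nth // size_take; case: ifP.
have jk1 : drop k.+1 h = drop (k.+1 - j) (drop j h) by rewrite drop_drop subnK // leqW.
apply: (nel y x); split.
- by apply: bdk; move: yk; rewrite jk1; exact: mem_drop.
- move=> b; have := mink j; rewrite ltnNge jk => h1.
  by suff : false by []; apply: h1; apply/asboolP.
- by right; exists (k.+1 - j)%N, u'; rewrite -jk1 wz.
Qed.

(** Simple paths have bounded length, so the infimum in [dist] is a minimum over a finite type. *)
Lemma shortest_path_exists S x y p0 : internal_path S x y p0 ->
  exists p, shortest_path S x y p.
Proof.
move=> ip0.
have szP p : internal_path S x y p -> (size p <= #|G|)%N.
  by case=> _ _ up _; apply: ltnW; rewrite -[(size p).+1]/(size (x :: p)) -(card_uniqP up) max_card.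
pose P (p : #|G|.-bseq G) := `[< internal_path S x y p >].
have P0 : P (Bseq (szP _ ip0)) by apply/asboolP.
case: (@arg_minP _ _ _ _ P (fun p : #|G|.-bseq G => walk_length x p) P0) => p /asboolP ip minp.
exists p; split => //; apply/eqP; rewrite eq_le dist_le_path // andbT.
apply: le_ereal_inf_tmp => _ [q [iq ->]]; rewrite lee_fin.
by apply: (minp (Bseq (szP _ iq))); apply/asboolP.
Qed.

Definition inner_edge h : rel G :=
  fun x y => [&& edge x y, x \in h & y \in h].

(** Invariant of runs that guarantees the shortest paths they have to follow. *)
Definition inner_connected h : Prop :=
  forall x y, x \in h -> y \in h -> connect (inner_edge h) x y.

Lemma inner_connected_path h x y : inner_connected h -> x \in h -> y \in h ->
  exists p, shortest_path (explored h) x y p.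
Proof.
move=> ch xh yh; have /connectP[p0 pp0 lp0] := ch x y xh yh.
have se : subrel (inner_edge h) (@edge R G) by move=> a b /and3P[].
have [p [pp lp up _]] := walk_shorten se pp0.
apply: (@shortest_path_exists _ _ _ p); split => //; first exact: sub_path pp.
  by rewrite lp.
have ph z : z \in p -> z \in h.
  elim: (p) (x) pp {up lp lp0 pp0} => [|a q IH] u //= /andP[/and3P[_ _ ah] pq].
  by rewrite inE => /orP[/eqP -> //|]; exact: IH pq.
apply/allP => z; rewrite in_explored => zb; apply: ph.
by case: (p) zb => [|a q] //= zb; apply: mem_belast.
Qed.

Lemma inner_connected_cons h x y : inner_connected h -> y \in h -> edge y x ->
  inner_connected (x :: h).
Proof.
move=> ch yh eyx.
have sub a b : a \in h -> b \in h -> connect (inner_edge (x :: h)) a b.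
  move=> ah bh; apply: connect_sub (ch a b ah bh) => c d /and3P[ecd ci di].
  by apply: connect1; rewrite /inner_edge ecd !inE ci di !orbT.
have yx : connect (inner_edge (x :: h)) y x.
  by apply: connect1; rewrite /inner_edge eyx !inE yh eqxx orbT.
have xy : connect (inner_edge (x :: h)) x y.
  by apply: connect1; rewrite /inner_edge edge_sym eyx !inE yh eqxx orbT.
move=> a b; rewrite !inE => /orP[/eqP ->|ah] /orP[/eqP ->|bh] //.
- exact: connect_trans xy (sub _ _ yh bh).
- exact: connect_trans (sub _ _ ah yh) yx.
- exact: sub.
Qed.

(** Induction on the number of unexplored vertices, which has dropped before both recursive calls
    since [x] is explored. *)
Lemma blocking_exists delta v h : v \in h -> inner_connected h ->
  exists p h', [/\ blocking delta v h p h', {subset h <= h'} & inner_connected h'].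
Proof.
move: {2}#|~: explored h| (leqnn #|~: explored h|) => n.
elim: n v h => [|n IH] v h hn vh ch;
  (case: (pselect (exists y x, eligible delta h v y x)) => [[y [x el]]|nel]; last first;
   first by exists [::], h; split => //; apply: Blocking_stop => y x el; apply: nel; exists y, x).
  have [[_ _ xh] _ _] := el.
  move: hn; rewrite leqn0 cards_eq0 => /eqP h0.
  by have : x \in ~: explored h; [rewrite finset.in_setC|rewrite h0 finset.inE].
have [[eyx yh xh] _ _] := el; rewrite in_explored in yh.
have lt : (#|~: explored (x :: h)| <= n)%N.
  rewrite -ltnS; apply: leq_trans hn; apply/proper_card/fintype.properP; split.
    by rewrite finset.setCS -cat1s explored_cat.
  by exists x; rewrite finset.in_setC // in_explored mem_head.
have [p sp] := inner_connected_path ch vh yh.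
have [q [h1 [bq sh1 ch1]]] := IH x (x :: h) lt (mem_head _ _) (inner_connected_cons ch yh eyx).
have xh1 : x \in h1 by apply: sh1; exact: mem_head.
have hh1 : {subset h <= h1} by move=> z zh; apply: sh1; rewrite inE zh orbT.
have [r sr] := inner_connected_path ch1 xh1 (hh1 _ vh).
have lt1 : (#|~: explored h1| <= n)%N.
  apply: leq_trans lt; apply: subset_leq_card; rewrite finset.setCS.
  by apply/fintype.subsetP => z; rewrite !in_explored; exact: sh1.
have [s [h2 [bs sh2 ch2]]] := IH v h1 lt1 (hh1 _ vh) ch1.
exists (p ++ x :: q ++ r ++ s), h2; split => //; last by move=> z /hh1/sh2.
exact: (Blocking_step el sp bq sr bs).
Qed.

End Runs.

(** * Competitiveness *)

Section Competitive.
Variables (R : realType) (G : wgraph R).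
Implicit Types (x y z v : G) (p : seq G) (T D : {set {set G}}).

Fixpoint walk_edges x p : {set {set G}} :=
  if p is y :: q then [set x; y]%SET |: walk_edges y q else finset.set0.

Lemma walk_edges_sub x p : path (@edge R G) x p -> walk_edges x p \subset @graph_edges R G.
Proof.
elim: p x => [|y p IH] x /=; first by rewrite finset.sub0set.
case/andP => exy /IH sp; rewrite finset.subUset sp andbT finset.sub1set.
by have := adj_graph_edges x y; rewrite /adj exy.
Qed.

Lemma walk_edges_connect x p z : z \in x :: p -> connect (adj (walk_edges x p)) x z.
Proof.
elim: p x => [|y p IH] x; first by rewrite mem_seq1 => /eqP ->.
rewrite in_cons => /orP[/eqP -> //|/IH yz].
apply: connect_trans (_ : connect _ x y) _.
  by apply: connect1; rewrite /adj finset.setU11.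
by apply: connect_sub yz => a b ab; apply/connect1/(sub_adj _ ab)/finset.subsetUr.
Qed.

Lemma total_weight_ge0 D : 0 <= @total_weight R G D.
Proof. by apply: sumr_ge0 => e _; exact: edge_weight_ge0. Qed.

Lemma total_weight_walk_edges x p : path (@edge R G) x p ->
  total_weight (walk_edges x p) <= walk_length x p.
Proof.
elim: p x => [|y p IH] x /=; first by move=> _; rewrite /total_weight big_set0.
case/andP => exy /IH wp; rewrite -(edge_weightE exy).
case: (boolP ([set x; y]%SET \in walk_edges y p)) => h.
  rewrite (finset.setUidPr _) ?finset.sub1set //.
  by apply: le_trans wp _; rewrite lerDr edge_weight_ge0.
by rewrite /total_weight big_setU1 //= lerD2l.
Qed.

(** The edges of any closed tour connect all vertices, so together they weigh at least as much as
    [T]. *)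
Lemma total_weight_le_opt D T : tie_broken_mst D T -> ((total_weight T)%:E <= opt G)%E.
Proof.
case=> _ _ minT _; apply: le_ereal_inf_tmp => _ [x [p [[pp lp cov] ->]]].
rewrite lee_fin; apply: le_trans (total_weight_walk_edges pp).
apply: minT; first exact: walk_edges_sub.
apply/forallP => y; apply/forallP => z.
apply: connect_trans (walk_edges_connect (cov z)).
by rewrite connect_adj_sym walk_edges_connect.
Qed.

Lemma total_weight_setD_le T D :
  @total_weight R G D <= total_weight (D :\: T) + total_weight T.
Proof.
rewrite [leLHS]/total_weight (big_setID T) /= addrC lerD2l.
rewrite [leRHS]/total_weight [leRHS](big_setID D) /= [T :&: D]finset.setIC lerDl.
exact: total_weight_ge0.
Qed.

(** If [ln n] is at least 48, the clustering bound applies; otherwise [n] is below [expR 48], and so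
    is the number of charged edges. The summand 1 pays for those in [T]. *)
Lemma charged_weight_le v bs T : greedy (ln #|G|%:R) [:: v] bs ->
  tie_broken_mst (charged_edges bs) T ->
  \sum_(b <- bs) weight b.1 b.2 <=
    (1 + (50 * expR 24 + expR 48)) * total_weight T.
Proof.
move=> gr mst; set D := charged_edges bs in mst.
have G0 : (0 < #|G|)%N by apply/card_gt0P; exists v.
have d0 : 0 <= ln #|G|%:R :> R by rewrite ln_ge0 // ler1n.
have girth := fun a b q => @no_short_cycle R G _ v bs T a b q d0 gr mst.
have [TG cT _ _] := mst.
have DG : D \subset @graph_edges R G := charged_edges_sub gr.
rewrite -(total_weight_charged gr) -/D.
apply: le_trans (total_weight_setD_le T D) _.
have T0 := total_weight_ge0 T.
suff : total_weight (D :\: T) <= (50 * expR 24 + expR 48) * total_weight T by lra.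
case: (leP 48 (ln #|G|%:R : R)) => d48.
  apply: le_trans (lightness TG DG cT girth d48 (lexx _)) _.
  by rewrite ler_wpM2r // lerDl expR_ge0.
apply: le_trans (lightness_small TG DG cT d0 girth) _.
rewrite ler_wpM2r //; apply: le_trans (_ : expR 48 <= _); last first.
  by rewrite lerDr mulr_ge0 // expR_ge0.
apply: le_trans (_ : #|G|%:R <= _); last first.
  by rewrite -[leLHS]lnK ?posrE ?ltr0n // ler_expR ltW.
rewrite ler_nat; apply: leq_trans (_ : size bs <= _)%N.
  by rewrite /D /charged_edges cardsE -(size_map (fun b : G * G => [set b.1; b.2]%SET)) card_size.
have := card_uniqP (greedy_uniq gr); rewrite size_cat size_map addn1 => E.
by apply: ltnW; rewrite -E max_card.
Qed.

End Competitive.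

Theorem theorem2 (R : realType) :
  exists C : R, forall (G : wgraph R) (v : G),
    connected_graph G ->
    let n : nat := #|G| in
    (exists p : seq G, blocking_run (ln n%:R) v p) /\
    (forall p : seq G, blocking_run (ln n%:R) v p ->
      closed_tour v p /\
      ((walk_length v p)%:E <= (C * ln n%:R)%:E * opt G)%E).
Proof.
pose C1 : R := 1 + (50 * expR 24 + expR 48).
have C10 : 0 <= C1 by rewrite !addr_ge0 ?mulr_ge0 ?expR_ge0.
have ln2 : 0 < ln 2 :> R by rewrite ln_gt0 // ltr1n.
(* For [n >= 2] the factor [2 / ln 2 + 1] absorbs the additive 2 of [2 + ln n]; [C1] comes from
   [charged_weight_le]. *)
exists (2 * (2 / ln 2 + 1) * C1) => G v cG n.
have n0 : (0 < n)%N by apply/card_gt0P; exists v.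
have d0 : 0 <= ln n%:R :> R by rewrite ln_ge0 // ler1n.
have vv : v \in [:: v] by rewrite mem_head.
split.
  have [|p [h [run _ _]]] := @blocking_exists R G (ln n%:R) v [:: v] vv.
    by move=> x y; rewrite !mem_seq1 => /eqP -> /eqP ->.
  by exists p, h.
move=> p [h run].
have [bs [Eh gr [pp lp] sp wp]] := blocking_charge d0 run vv.
have [l [El fv fl]] := blocking_finished run vv.
have all_h : forall z, z \in h.
  apply: (@all_finished_explored R G (ln n%:R) h v cG).
  - by rewrite El mem_cat vv orbT.
  - by rewrite Eh; exact: greedy_uniq gr.
  - by move=> z; rewrite El mem_cat mem_seq1 => /orP[zl|/eqP ->]; rewrite -El //; exact: fl.
split.
  split => // z; have := all_h z; rewrite Eh /visited mem_cat mem_seq1 in_cons.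
  by case/orP => [/sp ->|->]; rewrite ?orbT.
have [T mst] := tie_broken_mst_exists (charged_edges bs) cG.
have wT := total_weight_le_opt mst.
have T0 := total_weight_ge0 T.
have wB := charged_weight_le gr mst; rewrite -/C1 in wB.
apply: le_trans (_ : ((2 * (2 / ln 2 + 1) * C1 * ln n%:R) * total_weight T)%:E <= _)%E; last first.
  rewrite EFinM lee_wpmul2l // lee_fin !mulr_ge0 //.
  by rewrite addr_ge0 // divr_ge0 // ltW.
rewrite lee_fin; apply: le_trans wp _.
(* With a single vertex [ln n] is 0, and the cost must vanish: nothing was charged. *)
case: (ltnP 1 n) => n1; last first.
  have bs0 : bs = [::].
    have := card_uniqP (greedy_uniq gr); rewrite size_cat size_map addn1 => E.
    have : (size bs < 1)%N by rewrite -E; apply: leq_trans n1; exact: max_card.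
    by case: (bs).
  rewrite bs0 big_nil mulr0 !mulr_ge0 //.
  by rewrite addr_ge0 // divr_ge0 // ltW.
have h1 : 2 + ln n%:R <= (2 / ln 2 + 1) * ln n%:R :> R.
  rewrite mulrDl mul1r lerD2r -mulrA [_ * ln _]mulrC mulrA ler_pdivlMr // ler_wpM2l //.
  by rewrite ler_ln ?posrE ?ltr0n // ler_nat.
apply: le_trans (_ : 2 * ((2 / ln 2 + 1) * ln n%:R) * (C1 * total_weight T) <= _); last first.
  by rewrite le_eqVlt; apply/orP; left; apply/eqP; ring.
apply: ler_pM => //.
- by rewrite mulr_ge0 // addr_ge0.
- by rewrite -(total_weight_charged gr) total_weight_ge0.
- by rewrite ler_wpM2l.
Qed.
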